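(* Let $a>0$ and let $w=\sigma+it$, $t\in\mathbb{R}$. For $z\in\mathbb{C}$ and $\alpha>0$ define $$G(z)=\int_{-\infty}^{\infty}w^{2z}e^{w^2}\,dt\ (\sigma>0),\qquad R(z,\alpha)=\int_{-\infty}^{\infty}w^{2z}\frac{e^{\alpha w^2}}{1-e^{w^2}}\,dt\ (\sigma\in(0,\sqrt{\pi})),$$ $$D(z,\alpha)=\int_{-\infty}^{\infty}w^{2z}\frac{e^{\alpha w^2}}{1+e^{w^2}}\,dt\ (\sigma\in(0,\sqrt{\pi/2})).$$ Then for every $s\in\mathbb{C}\setminus\{1,2,3,\dots\}$, $$\zeta(s,a)=\frac{R(s-\tfrac12,a)}{G(s-\tfrac12)},\qquad \eta(s,a)=\frac{D(s-\tfrac12,a)}{G(s-\tfrac12)},$$ where the first identity holds for any $\sigma\in(0,\sqrt{\pi})$ in the definition of $R$ and the second for any $\sigma\in(0,\sqrt{\pi/2})$ in the definition of $D$.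
   Context: Complex powers use the principal branch of the logarithm: $w^{2z}=\exp(2z\log w)$ with branch cut $(-\infty,0]$. $\zeta(s,a)$ is the Hurwitz zeta function, $\zeta(s,a)=\sum_{n=0}^{\infty}(n+a)^{-s}$ for $\operatorname{Re}(s)>1$, meromorphically continued to $\mathbb{C}$; $\eta(s,a)$ is the alternating Hurwitz zeta function, $\eta(s,a)=\sum_{n=0}^{\infty}(-1)^n(n+a)^{-s}$ for $\operatorname{Re}(s)>1$, analytically continued. *)

(* Defs.v *)
(* Stdlib reals with Coquelicot: complex numbers [C], power series, improper
   Riemann integrals of C-valued functions. *)
From Stdlib Require Import Reals.
From Coquelicot Require Import Coquelicot.

Set Implicit Arguments.
Unset Strict Implicit.
Unset Printing Implicit Defensive.

Open Scope R_scope.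

Definition Cexp (z : C) : C :=
  (exp (Re z) * cos (Im z), exp (Re z) * sin (Im z)).

(* Principal argument, with values in (-PI, PI]; a junk value at 0. *)
Definition Carg (w : C) : R :=
  if Rle_dec 0 (Im w) then acos (Re w / Cmod w) else - acos (Re w / Cmod w).

Definition Clog (w : C) : C := (ln (Cmod w), Carg w).

Definition Cpower (w z : C) : C := Cexp (z * Clog w)%C.

Definition analytic_at (f : C -> C) (c : C) : Prop :=
  exists (r : R) (u : nat -> C), 0 < r /\
    forall z : C, Cmod (z - c)%C < r ->
      is_pseries (K := C_AbsRing) (V := C_NormedModule) u (z - c)%C (f z).

(* At worst a pole at c; the value f c is irrelevant. *)
Definition meromorphic_at (f : C -> C) (c : C) : Prop :=
  exists (r : R) (k : nat) (g : C -> C), 0 < r /\ analytic_at g c /\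
    forall z : C, 0 < Cmod (z - c)%C < r ->
      (Cpow (z - c) k * f z)%C = g z.

(* [is_hurwitz_zeta a Z]: Z is the function zeta( . , a), i.e. the meromorphic
   continuation to C of its Dirichlet-type series; its only pole is at 1, where
   the value of Z is unconstrained.  By the identity theorem these conditions
   determine Z on C \ {1}. *)
Definition is_hurwitz_zeta (a : R) (Z : C -> C) : Prop :=
  (forall s : C, 1 < Re s ->
     is_series (K := C_AbsRing) (V := C_NormedModule)
       (fun n : nat => Cpower (RtoC (INR n + a)) (- s)%C) (Z s)) /\
  (forall s : C, s <> RtoC 1 -> analytic_at Z s) /\
  meromorphic_at Z (RtoC 1).

(* Likewise for eta( . , a), whose continuation is entire. *)
Definition is_alternating_hurwitz_zeta (a : R) (E : C -> C) : Prop :=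
  (forall s : C, 1 < Re s ->
     is_series (K := C_AbsRing) (V := C_NormedModule)
       (fun n : nat => (RtoC ((-1) ^ n) * Cpower (RtoC (INR n + a)) (- s))%C)
       (E s)) /\
  (forall s : C, analytic_at E s).

(* Integral over the whole real line, both endpoints tending to infinity
   independently.  [integral_R] is total; [ex_integral_R] says it converges. *)
Definition ex_integral_R (f : R -> C) : Prop :=
  ex_RInt_gen (V := C_R_NormedModule) f
    (Rbar_locally m_infty) (Rbar_locally p_infty).

Definition integral_R (f : R -> C) : C :=
  RInt_gen (V := C_R_CompleteNormedModule) f
    (Rbar_locally m_infty) (Rbar_locally p_infty).

(* The integrands in t, along w = sigma + i t. *)
Definition G_integrand (sigma : R) (z : C) (t : R) : C :=
  let w : C := (sigma, t) in
  (Cpower w (2 * z) * Cexp (w * w))%C.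

Definition R_integrand (sigma : R) (z : C) (alpha : R) (t : R) : C :=
  let w : C := (sigma, t) in
  (Cpower w (2 * z) * (Cexp (alpha * (w * w)) / (1 - Cexp (w * w))))%C.

Definition D_integrand (sigma : R) (z : C) (alpha : R) (t : R) : C :=
  let w : C := (sigma, t) in
  (Cpower w (2 * z) * (Cexp (alpha * (w * w)) / (1 + Cexp (w * w))))%C.

Definition G_fun (sigma : R) (z : C) : C := integral_R (G_integrand sigma z).

Definition R_fun (sigma : R) (z : C) (alpha : R) : C :=
  integral_R (R_integrand sigma z alpha).

Definition D_fun (sigma : R) (z : C) (alpha : R) : C :=
  integral_R (D_integrand sigma z alpha).

(* Main.v *)
(** All three integrals are instances of
    [I(eps, alpha) = \int w^(2z) e^(alpha w^2) / (1 - eps e^(w^2)) dt] on the line [Re w = sigma],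
    with [eps = 1] for [R], [eps = -1] for [D] and [eps = 0] for [G].

    The value does not depend on [sigma] as long as no pole is crossed.  Rescaling [w] gives
    [I(0, c) = c^(-s) G] for [c > 0], [s = z + 1/2], so the finite geometric identity
    [1/(1 - x) = 1 + x + ... + x^N + x^(N+1)/(1 - x)] yields
    [I(eps, a) = (sum_(n <= N) eps^n (n+a)^(-s)) G + eps^(N+1) I(eps, a+N+1)].  On the line
    [sigma^2 = 1/(a+N+1)] the remainder is [O(1/N)] when [Re s >= 5/2], because the zero of
    [1 - e^(w^2)] at the origin is then absorbed by [w^(2z)].  Both sides are analytic in [s] along
    every segment avoiding [1], and the identity theorem extends the equality.

    Finally [G <> 0].  Integration by parts gives [G(z+1) = -(z+1/2) G(z)], so a zero at an
    admissible [z] is also a zero at every [z-n].  On the line [sigma^2 = n], through the saddle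
    point, the integrand of [G(z-n)] is, up to a nonzero constant, [e^(-2t^2) + O(1/sqrt n)],
    whose integral is nonzero for large [n]. *)

Require Import Defs.
From Stdlib Require Import Reals Lra Lia Psatz Factorial Arith FunctionalExtensionality.
From Coquelicot Require Import Coquelicot.

Open Scope R_scope.

(** * Complex exponential and principal logarithm *)

(** By Hankel's formula [G(s - 1/2)] is [PI / Gamma(1 - s)], whose zeros are exactly the positive
    integers; hence their exclusion. The functional equation of Gamma appears as the recurrence
    obtained by parts, Stirling's asymptotics as the saddle-point limit.

    Complex analysis is reduced to real calculus. Moving the line is differentiation of a truncated
    integral in the abscissa, through the Cauchy-Riemann equations. Convergence comes from a
    majorant [M / (1 + t^2)], whose primitive is an arctangent. Analyticity in [s] is used along one
    segment, as a real power series: [w^(2(c + h d))] is [w^(2c) e^(2 h d log w)], [log w] grows at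
    most linearly in [t], and Gaussian decay beats [e^(C |t|)] for every [C], so the second factor
    may be expanded under the integral sign.

    What forces a moving line in the remainder estimate is that [e^(alpha w^2)] has size
    [e^(alpha sigma^2)] on a fixed line and explodes with [alpha]. With [sigma^2 = 1 / alpha] its
    modulus is [e^(1 - alpha t^2)], so effectively [|w|^2] is of order [1 / alpha]. *)

Lemma C_ext (a b : C) : Re a = Re b -> Im a = Im b -> a = b.
Proof. destruct a, b; simpl; intros; congruence. Qed.

Lemma Cexp_plus (a b : C) : Cexp (a + b)%C = (Cexp a * Cexp b)%C.
Proof.
  destruct a, b; apply C_ext; simpl; rewrite exp_plus; [rewrite cos_plus | rewrite sin_plus]; ring.
Qed.

Lemma Cexp_0 : Cexp (RtoC 0) = RtoC 1.
Proof. apply C_ext; unfold Cexp; simpl; rewrite exp_0, ?cos_0, ?sin_0; ring. Qed.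

Lemma Cexp_RtoC (x : R) : Cexp (RtoC x) = RtoC (exp x).
Proof. apply C_ext; unfold Cexp; simpl; rewrite ?cos_0, ?sin_0; ring. Qed.

Lemma Cmod_Cexp (a : C) : Cmod (Cexp a) = exp (Re a).
Proof.
  unfold Cmod, Cexp; simpl.
  replace (_ + _) with (exp (Re a) ^ 2 * (Rsqr (sin (Im a)) + Rsqr (cos (Im a))))
    by (unfold Rsqr; ring).
  rewrite sin2_cos2, Rmult_1_r.
  apply sqrt_pow2, Rlt_le, exp_pos.
Qed.

Lemma Cmod_ge_Re (w : C) : Rabs (Re w) <= Cmod w.
Proof. apply Rle_trans with (2 := Rmax_Cmod w), Rmax_l. Qed.

Lemma Cmod_ge_Im (w : C) : Rabs (Im w) <= Cmod w.
Proof. apply Rle_trans with (2 := Rmax_Cmod w), Rmax_r. Qed.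

Lemma Cmod_le_sum (w : C) : Cmod w <= Rabs (Re w) + Rabs (Im w).
Proof.
  destruct w as [x y]; simpl.
  replace (x, y) with (RtoC x + Ci * RtoC y)%C
    by (apply C_ext; simpl; ring).
  apply Rle_trans with (1 := Cmod_triangle _ _).
  rewrite Cmod_mult, !Cmod_R.
  replace (Cmod Ci) with 1; [lra |].
  unfold Cmod, Ci; simpl.
  replace (0 * (0 * 1) + 1 * (1 * 1)) with 1 by ring; now rewrite sqrt_1.
Qed.

Lemma Cmod_sqr (w : C) : Cmod w * Cmod w = Re w ^ 2 + Im w ^ 2.
Proof.
  unfold Cmod, Re, Im; rewrite sqrt_sqrt; [reflexivity |].
  generalize (pow2_ge_0 (fst w)) (pow2_ge_0 (snd w)); lra.
Qed.

Lemma Re_pos_Cmod (w : C) : 0 < Re w -> 0 < Cmod w.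
Proof.
  intros H; apply Rlt_le_trans with (2 := Cmod_ge_Re w); rewrite Rabs_pos_eq; lra.
Qed.

Lemma sqrt_1_slope (w : C) : 0 < Re w -> sqrt (1 + (Im w / Re w)²) = Cmod w / Re w.
Proof.
  intros Hx; assert (Hm := Re_pos_Cmod w Hx).
  replace (1 + (Im w / Re w)²) with ((Cmod w / Re w) ^ 2).
  - apply sqrt_pow2, Rlt_le, Rdiv_lt_0_compat; lra.
  - replace (1 + (Im w / Re w)²) with ((Re w ^ 2 + Im w ^ 2) / Re w ^ 2)
      by (unfold Rsqr; field; lra).
    rewrite <- Cmod_sqr; field; lra.
Qed.

(** On the right half plane the case split in [Carg] disappears, because [atan] is smooth across the
    real axis; continuity and differentiability of the logarithm are proved from this formula. The
    quotient under [acos] is the cosine of this angle. *)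
Lemma Carg_atan (w : C) : 0 < Re w -> Carg w = atan (Im w / Re w).
Proof.
  intros Hx.
  assert (Hm : 0 < Cmod w).
  { apply Rlt_le_trans with (2 := Cmod_ge_Re w). rewrite Rabs_pos_eq; lra. }
  assert (Hs := Cmod_sqr w).
  assert (Hb := atan_bound (Im w / Re w)).
  assert (Hc : Re w / Cmod w = cos (atan (Im w / Re w))).
  { assert (Hcp : 0 < cos (atan (Im w / Re w))) by (apply cos_gt_0; lra).
    rewrite cos_atan.
    rewrite sqrt_1_slope by trivial; field; lra. }
  unfold Carg; rewrite Hc; destruct Rle_dec as [Hy | Hy].
  - rewrite acos_cos; [reflexivity |].
    split; [|lra].
    rewrite <- atan_0. destruct Hy as [Hy | Hy].
    + apply Rlt_le, atan_increasing, Rdiv_lt_0_compat; lra.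
    + rewrite <- Hy; unfold Rdiv; rewrite Rmult_0_l; lra.
  - rewrite <- (cos_neg (atan _)), acos_cos; [ring |].
    split; [|lra].
    apply Rnot_le_lt in Hy.
    assert (atan (Im w / Re w) < 0); [|lra].
    rewrite <- atan_0; apply atan_increasing.
    apply Rdiv_neg_pos; lra.
Qed.

Lemma Clog_atan (w : C) :
  0 < Re w -> Clog w = (ln (sqrt (Re w ^ 2 + Im w ^ 2)), atan (Im w / Re w)).
Proof. intros H; unfold Clog; rewrite Carg_atan; trivial. Qed.

Lemma Clog_scal (k : R) (w : C) :
  0 < k -> 0 < Re w -> Clog (RtoC k * w)%C = (RtoC (ln k) + Clog w)%C.
Proof.
  intros Hk Hw.
  assert (0 < Re (RtoC k * w)%C) by (destruct w; simpl in *; nra).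
  unfold Clog; rewrite !Carg_atan by trivial.
  apply C_ext; simpl.
  - rewrite Cmod_mult, Cmod_R, (Rabs_pos_eq k), ln_mult; try lra.
    now apply Re_pos_Cmod.
  - rewrite Rplus_0_l; f_equal; destruct w; simpl in *; field; split; lra.
Qed.

Lemma Clog_RtoC (k : R) : 0 < k -> Clog (RtoC k) = RtoC (ln k).
Proof.
  intros Hk; unfold Clog; rewrite Carg_atan by trivial.
  apply C_ext; simpl.
  - now rewrite Cmod_R, Rabs_pos_eq by lra.
  - unfold Rdiv; now rewrite Rmult_0_l, atan_0.
Qed.

Lemma Cexp_Clog (w : C) : 0 < Re w -> Cexp (Clog w) = w.
Proof.
  intros Hw; unfold Clog; rewrite Carg_atan by trivial.
  assert (Hm := Re_pos_Cmod w Hw).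
  assert (Hs := Cmod_sqr w).
  apply C_ext; unfold Cexp; simpl; rewrite exp_ln by trivial;
    [rewrite cos_atan | rewrite sin_atan];
    rewrite sqrt_1_slope by trivial; field; lra.
Qed.

Lemma ln_le_self (x : R) : 0 < x -> ln x <= x.
Proof.
  intros Hx; pose proof (exp_ineq1_le (ln x)) as H.
  rewrite exp_ln in H; lra.
Qed.

(** A crude bound: what matters is that the growth in [Im w] is linear, hence beaten by a Gaussian
    after exponentiation. The lower bound [m] keeps it uniform on vertical strips. The 2 bounds the
    argument, since [PI / 2 <= 2]. *)
Lemma Cmod_Clog_le (w : C) (m : R) :
  0 < m <= Re w -> Cmod (Clog w) <= Rabs (ln m) + 2 + Re w + Rabs (Im w).
Proof.
  intros Hw.
  apply Rle_trans with (1 := Cmod_le_sum _).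
  unfold Clog; rewrite Carg_atan by lra; simpl.
  assert (Rabs (atan (Im w / Re w)) <= 2).
  { assert (Hb := atan_bound (Im w / Re w)). assert (H4 := PI_4).
    apply Rabs_le; lra. }
  assert (Hm : m <= Cmod w).
  { apply Rle_trans with (2 := Cmod_ge_Re w); rewrite Rabs_pos_eq; lra. }
  assert (Rabs (ln (Cmod w)) <= Rabs (ln m) + Re w + Rabs (Im w)); [|lra].
  assert (ln m <= ln (Cmod w)) by (apply ln_le; lra).
  assert (ln (Cmod w) <= Cmod w) by (apply ln_le_self; lra).
  assert (Hc := Cmod_le_sum w); rewrite (Rabs_pos_eq (Re w)) in Hc by lra.
  assert (- Rabs (ln m) <= ln m) by (unfold Rabs; destruct Rcase_abs; lra).
  assert (0 <= Rabs (ln m)) by apply Rabs_pos.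
  apply Rabs_le; generalize (Rabs_pos (Im w)); lra.
Qed.

(** * Continuity and differentiability along curves *)

Lemma continuous_C (U : UniformSpace) (F : U -> C) (w : U) :
  continuous (fun w => Re (F w)) w -> continuous (fun w => Im (F w)) w ->
  continuous F w.
Proof.
  intros H1 H2.
  apply continuous_ext with (fun w => (Re (F w), Im (F w))).
  { intros x; now destruct (F x). }
  apply (continuous_comp_2 (fun w => Re (F w)) (fun w => Im (F w)) (fun x y => (x, y)) w H1 H2).
  apply continuous_ext with (fun x => x); [now intros [] | apply continuous_id].
Qed.

Lemma continuous_Re (U : UniformSpace) (F : U -> C) (w : U) :
  continuous F w -> continuous (fun w => Re (F w)) w.
Proof.
  intros H; apply (continuous_comp F Re w H).
  destruct (F w); apply continuous_fst.
Qed.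

Lemma continuous_Im (U : UniformSpace) (F : U -> C) (w : U) :
  continuous F w -> continuous (fun w => Im (F w)) w.
Proof.
  intros H; apply (continuous_comp F Im w H).
  destruct (F w); apply continuous_snd.
Qed.

Lemma continuous_Cplus (U : UniformSpace) (F G : U -> C) (w : U) :
  continuous F w -> continuous G w -> continuous (fun w => F w + G w)%C w.
Proof. apply (continuous_plus (V := C_R_NormedModule)). Qed.

Lemma continuous_Cmult (U : UniformSpace) (F G : U -> C) (w : U) :
  continuous F w -> continuous G w -> continuous (fun w => F w * G w)%C w.
Proof.
  intros HF HG.
  assert (HF1 := continuous_Re _ _ _ HF); assert (HF2 := continuous_Im _ _ _ HF).
  assert (HG1 := continuous_Re _ _ _ HG); assert (HG2 := continuous_Im _ _ _ HG).
  apply continuous_C.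
  - exact (continuous_minus (V := R_NormedModule) _ _ _
      (continuous_mult (K := R_AbsRing) _ _ _ HF1 HG1)
      (continuous_mult (K := R_AbsRing) _ _ _ HF2 HG2)).
  - exact (continuous_plus (V := R_NormedModule) _ _ _
      (continuous_mult (K := R_AbsRing) _ _ _ HF1 HG2)
      (continuous_mult (K := R_AbsRing) _ _ _ HF2 HG1)).
Qed.

Lemma continuous_Cexp (w : C) : continuous Cexp w.
Proof.
  assert (HR : continuous Re w) by (destruct w; apply continuous_fst).
  assert (HI : continuous Im w) by (destruct w; apply continuous_snd).
  apply continuous_C; simpl; apply (continuous_mult (K := R_AbsRing)).
  - apply continuous_comp with (1 := HR), continuous_exp.
  - apply continuous_comp with (1 := HI), continuous_cos.
  - apply continuous_comp with (1 := HR), continuous_exp.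
  - apply continuous_comp with (1 := HI), continuous_sin.
Qed.

Lemma continuous_real (f : R -> R) (x d : R) :
  is_derive f x d -> continuous f x.
Proof. intros H; apply (ex_derive_continuous (V := R_NormedModule)); now exists d. Qed.

Lemma continuous_norm2 (w : C) : continuous (fun w : C => Re w ^ 2 + Im w ^ 2) w.
Proof.
  assert (HR : continuous Re w) by (destruct w; apply continuous_fst).
  assert (HI : continuous Im w) by (destruct w; apply continuous_snd).
  apply (continuous_plus (V := R_NormedModule)).
  - apply (continuous_comp Re (fun x => x ^ 2)); [trivial|].
    eapply continuous_real; auto_derive; reflexivity.
  - apply (continuous_comp Im (fun x => x ^ 2)); [trivial|].
    eapply continuous_real; auto_derive; reflexivity.
Qed.

Lemma norm2_pos (w : C) : w <> RtoC 0 -> 0 < Re w ^ 2 + Im w ^ 2.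
Proof.
  intros H; rewrite <- Cmod_sqr.
  apply Cmod_gt_0 in H; nra.
Qed.

Lemma continuous_Cinv (w : C) : w <> RtoC 0 -> continuous Cinv w.
Proof.
  intros Hw; apply norm2_pos in Hw.
  assert (HR : continuous Re w) by (destruct w; apply continuous_fst).
  assert (HI : continuous Im w) by (destruct w; apply continuous_snd).
  assert (HN : continuous (fun w : C => / (Re w ^ 2 + Im w ^ 2)) w).
  { apply (continuous_comp (fun w : C => Re w ^ 2 + Im w ^ 2) Rinv).
    - apply continuous_norm2.
    - apply continuous_Rinv; lra. }
  apply continuous_C; simpl; apply (continuous_mult (K := R_AbsRing)); trivial.
  now apply (continuous_opp (V := R_NormedModule)).
Qed.

Lemma locally_Re_pos (w : C) : 0 < Re w -> locally w (fun w : C => 0 < Re w).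
Proof.
  intros Hw.
  assert (HR : continuous Re w) by (destruct w; apply continuous_fst).
  apply (HR (fun x => 0 < x)), (locally_interval _ _ 0 p_infty); simpl; trivial.
Qed.

Lemma continuous_Clog (w : C) : 0 < Re w -> continuous Clog w.
Proof.
  intros Hw.
  assert (HR : continuous Re w) by (destruct w; apply continuous_fst).
  assert (HI : continuous Im w) by (destruct w; apply continuous_snd).
  apply continuous_ext_loc with
    (fun w : C => (ln (sqrt (Re w ^ 2 + Im w ^ 2)), atan (Im w / Re w)) : C).
  { generalize (locally_Re_pos w Hw); apply filter_imp.
    intros x Hx; symmetry; now apply Clog_atan. }
  apply continuous_C; simpl.
  - apply (continuous_comp (fun w : C => Re w ^ 2 + Im w ^ 2) (fun x => ln (sqrt x))).
    + apply continuous_norm2.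
    + assert (0 < Re w ^ 2 + Im w ^ 2) by (generalize (pow2_ge_0 (Im w)); nra).
      eapply continuous_real; auto_derive; [|reflexivity].
      repeat split; trivial; now apply sqrt_lt_R0.
  - apply (continuous_comp (fun w : C => Im w / Re w) atan).
    + apply (continuous_mult (K := R_AbsRing)); trivial.
      apply continuous_comp with (1 := HR), continuous_Rinv; lra.
    + eapply continuous_real; auto_derive; trivial.
Qed.

Definition Cderiv (g : R -> C) (x : R) (d : C) :=
  is_derive (fun t => Re (g t)) x (Re d) /\ is_derive (fun t => Im (g t)) x (Im d).

(* Complex differentiability is encoded as the chain rule along every
   differentiable curve, so that compositions need no argument at all. *)
Definition hol (F F' : C -> C) (w : C) :=
  forall (g : R -> C) (x : R) (d : C), g x = w -> Cderiv g x d ->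
    Cderiv (fun t => F (g t)) x (F' w * d)%C.

Lemma Cderiv_ext (g h : R -> C) (x : R) (d e : C) :
  (forall t, g t = h t) -> d = e -> Cderiv g x d -> Cderiv h x e.
Proof.
  intros H -> [H1 H2]; split; [revert H1 | revert H2];
    apply is_derive_ext; intros t; now rewrite H.
Qed.

Lemma Cderiv_continuous (g : R -> C) (x : R) (d : C) :
  Cderiv g x d -> continuous g x.
Proof.
  intros [H1 H2]; apply continuous_C; eapply continuous_real; eassumption.
Qed.

Lemma is_derive_Rmult (f g : R -> R) (x a b : R) :
  is_derive f x a -> is_derive g x b ->
  is_derive (fun t => f t * g t) x (a * g x + f x * b).
Proof. intros Hf Hg; exact (is_derive_mult f g x a b Hf Hg Rmult_comm). Qed.

Lemma Cderiv_mult (g h : R -> C) (x : R) (d e : C) :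
  Cderiv g x d -> Cderiv h x e ->
  Cderiv (fun t => g t * h t)%C x (d * h x + g x * e)%C.
Proof.
  intros [H1 H2] [H3 H4]; split.
  - evar_last.
    + exact (is_derive_minus (V := R_NormedModule) _ _ _ _ _
        (is_derive_Rmult _ _ _ _ _ H1 H3) (is_derive_Rmult _ _ _ _ _ H2 H4)).
    + unfold minus, plus, opp; simpl; unfold Re, Im; ring.
  - evar_last.
    + exact (is_derive_plus (V := R_NormedModule) _ _ _ _ _
        (is_derive_Rmult _ _ _ _ _ H1 H4) (is_derive_Rmult _ _ _ _ _ H2 H3)).
    + unfold plus; simpl; unfold Re, Im; ring.
Qed.

Lemma hol_const (c w : C) : hol (fun _ => c) (fun _ => RtoC 0) w.
Proof.
  intros g x d _ _.
  replace (RtoC 0 * d)%C with (RtoC 0) by ring.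
  split; apply (is_derive_const (V := R_NormedModule)).
Qed.

Lemma hol_id (w : C) : hol (fun w => w) (fun _ => RtoC 1) w.
Proof.
  intros g x d _; apply Cderiv_ext; [trivial | ring].
Qed.

Lemma hol_plus (F F' G G' : C -> C) (w : C) :
  hol F F' w -> hol G G' w -> hol (fun w => F w + G w)%C (fun w => F' w + G' w)%C w.
Proof.
  intros HF HG g x d Hg Hd.
  destruct (HF g x d Hg Hd) as [H1 H2], (HG g x d Hg Hd) as [H3 H4].
  replace ((F' w + G' w) * d)%C with (F' w * d + G' w * d)%C by ring.
  split; apply (is_derive_plus (V := R_NormedModule)); trivial.
Qed.

Lemma hol_mult (F F' G G' : C -> C) (w : C) :
  hol F F' w -> hol G G' w ->
  hol (fun w => F w * G w)%C (fun w => F' w * G w + F w * G' w)%C w.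
Proof.
  intros HF HG g x d Hg Hd.
  generalize (Cderiv_mult _ _ _ _ _ (HF g x d Hg Hd) (HG g x d Hg Hd)).
  apply Cderiv_ext; [trivial |]. rewrite Hg; ring.
Qed.

(** [auto_derive] leaves [Derive u x] and [Derive v x] for abstract curves; both are replaced by the
    derivatives recorded in [H1] and [H2]. *)
Ltac derive_with u v H1 H2 :=
  auto_derive;
  [ repeat split; try (eexists; eassumption); simpl in *; try lra
  | let E1 := fresh in let E2 := fresh in
    match type of H1 with is_derive _ ?x ?a =>
      assert (E1 : Derive (fun t : R => u t) x = a) by exact (is_derive_unique u x a H1) end;
    match type of H2 with is_derive _ ?x ?b =>
      assert (E2 : Derive (fun t : R => v t) x = b) by exact (is_derive_unique v x b H2) end;
    rewrite E1, E2; clear E1 E2 ].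

Lemma hol_Cexp (F F' : C -> C) (w : C) :
  hol F F' w -> hol (fun w => Cexp (F w)) (fun w => F' w * Cexp (F w))%C w.
Proof.
  intros HF g x d Hg Hd.
  destruct (HF g x d Hg Hd) as [H1 H2].
  (* The curve is first given by two abstract real components, so that only real derivatives have to
     be computed. *)
  assert (A : forall (u v : R -> R) (a b : R), is_derive u x a -> is_derive v x b ->
    Cderiv (fun t => Cexp (u t, v t)) x ((a, b) * Cexp (u x, v x))%C).
  { clear; intros u v a b H1 H2; split; simpl; derive_with u v H1 H2; ring. }
  apply A with (1 := H1) in H2; revert H2; rewrite <- Hg; clear.
  apply Cderiv_ext; [intros t; now destruct (F (g t)) |].
  destruct (F (g x)), (F' (g x)), d; apply C_ext; simpl; ring.
Qed.

Lemma hol_inv (F F' : C -> C) (w : C) :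
  F w <> RtoC 0 -> hol F F' w ->
  hol (fun w => / F w)%C (fun w => - F' w * (/ F w * / F w))%C w.
Proof.
  intros H0 HF g x d Hg Hd.
  destruct (HF g x d Hg Hd) as [H1 H2].
  rewrite <- Hg in *; apply norm2_pos in H0.
  assert (A : forall (u v : R -> R) (a b : R), 0 < u x ^ 2 + v x ^ 2 ->
    is_derive u x a -> is_derive v x b ->
    Cderiv (fun t => / (u t, v t))%C x (- (a, b) * (/ (u x, v x) * / (u x, v x)))%C).
  { clear; intros u v a b H0 H1 H2; split; simpl; derive_with u v H1 H2; field; simpl in *; lra. }
  generalize (A _ _ _ _ H0 H1 H2); clear.
  apply Cderiv_ext; [intros t; now destruct (F (g t)) |].
  destruct (F (g x)), (F' (g x)), d; apply C_ext; simpl; ring.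
Qed.

Lemma hol_Clog (w : C) : 0 < Re w -> hol Clog Cinv w.
Proof.
  intros Hw g x d Hg [H1 H2]; rewrite <- Hg in *.
  assert (L : locally x (fun t => 0 < Re (g t))).
  { apply (continuous_real _ _ _ H1 (fun y => 0 < y)), (locally_interval _ _ 0 p_infty);
      simpl; trivial. }
  assert (A : forall (u v : R -> R) (a b : R), 0 < u x ->
    is_derive u x a -> is_derive v x b ->
    Cderiv (fun t => (ln (sqrt (u t ^ 2 + v t ^ 2)), atan (v t / u t))) x
      (/ (u x, v x) * (a, b))%C).
  { clear; intros u v a b H0 H1 H2.
    assert (Hp : 0 < u x ^ 2 + v x ^ 2) by (generalize (pow2_ge_0 (v x)); nra).
    assert (Hq := sqrt_lt_R0 _ Hp); assert (Hs := sqrt_sqrt _ (Rlt_le _ _ Hp)).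
    split; simpl in *; derive_with u v H1 H2.
    - set (q := sqrt _) in *.
      transitivity ((u x * a + v x * b) / (q * q)); [field; lra |].
      rewrite Hs; field; lra.
    - field; split; nra. }
  generalize (A _ _ _ _ Hw H1 H2); clear - L.
  (* The arctangent formula for [Clog] holds only where the real part is positive, so the two curves
     are compared on a neighbourhood of [x]. *)
  assert (E : locally x (fun t =>
    (ln (sqrt (Re (g t) ^ 2 + Im (g t) ^ 2)), atan (Im (g t) / Re (g t))) = Clog (g t))).
  { revert L; apply filter_imp; intros t Ht; now rewrite Clog_atan. }
  replace (/ (Re (g x), Im (g x)) * (Re d, Im d))%C with (/ g x * d)%C
    by (destruct (g x), d; reflexivity).
  intros [H1 H2]; split; [revert H1 | revert H2]; apply is_derive_ext_loc;
    revert E; apply filter_imp; intros t Ht; now rewrite Ht.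
Qed.

(** * Dominated integrals over the real line *)

Lemma norm_C (z : C) : norm (V := C_R_NormedModule) z = Cmod z.
Proof.
  unfold norm, Cmod; simpl; unfold prod_norm, norm; simpl; unfold abs; simpl.
  f_equal; generalize (pow2_abs (fst z)) (pow2_abs (snd z)); simpl; lra.
Qed.

Lemma atan_lim_p : filterlim atan (Rbar_locally p_infty) (locally (PI / 2)).
Proof.
  apply filterlim_ext_loc with (fun x => PI / 2 - atan (/ x)).
  { exists 0; intros x Hx; rewrite atan_inv by trivial; ring. }
  assert (H : filterlim (fun x => atan (/ x)) (Rbar_locally p_infty) (locally 0)).
  { apply filterlim_comp with (locally 0).
    - apply (filterlim_Rbar_inv p_infty); discriminate.
    - rewrite <- atan_0 at 2; apply continuous_atan. }
  generalize (filterlim_comp _ _ _ _ (fun y => PI / 2 - y) _ _ _ H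
    (continuous_minus (V := R_NormedModule) _ _ _ (continuous_const _ _) (continuous_id _))).
  unfold minus, plus, opp; simpl; now rewrite Ropp_0, Rplus_0_r.
Qed.

Lemma atan_lim_m : filterlim atan (Rbar_locally m_infty) (locally (- (PI / 2))).
Proof.
  apply filterlim_ext with (fun x => - atan (- x)).
  { intros x; rewrite atan_opp; ring. }
  apply filterlim_comp with (locally (PI / 2)).
  - apply filterlim_comp with (Rbar_locally p_infty); [|apply atan_lim_p].
    apply (filterlim_Rbar_opp m_infty).
  - exact (continuous_opp (V := R_NormedModule) _ _ (continuous_id _)).
Qed.

(** Splitting at 0 decouples the endpoints: each one tends to its infinity on its own. *)
Lemma is_RInt_gen_primitive (V : CompleteNormedModule R_AbsRing) (f F : R -> V) (l m : V) :
  (forall x, is_RInt f 0 x (F x)) ->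
  filterlim F (Rbar_locally p_infty) (locally l) ->
  filterlim F (Rbar_locally m_infty) (locally m) ->
  is_RInt_gen f (Rbar_locally m_infty) (Rbar_locally p_infty) (minus l m).
Proof.
  intros HF Hl Hm P HP.
  assert (L : filterlim (fun ab : R * R => minus (F (snd ab)) (F (fst ab)))
    (filter_prod (Rbar_locally m_infty) (Rbar_locally p_infty)) (locally (minus l m))).
  { apply (filterlim_comp_2 (G := locally l) (H := locally (opp m))
      (fun ab : R * R => F (snd ab)) (fun ab : R * R => opp (F (fst ab))) plus).
    - apply filterlim_comp with (2 := Hl), filterlim_snd.
    - apply filterlim_comp with (locally m); [|exact (filterlim_opp (V := V) m)].
      apply filterlim_comp with (2 := Hm), filterlim_fst.
    - apply (filterlim_plus (V := V)). }
  generalize (L P HP); unfold filtermap, filtermapi; apply filter_imp; intros [a b] H; simpl in *.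
  exists (minus (F b) (F a)); split; [|trivial].
  replace (minus (F b) (F a)) with (plus (opp (F a)) (F b)) by apply plus_comm.
  apply (is_RInt_Chasles (V := V)) with 0; [apply (is_RInt_swap (V := V))|]; apply HF.
Qed.

(** This majorant has the explicit primitive [M * atan t], with finite limits at both ends and total
    mass [M * PI]; it gives convergence and a bound on the integral at once. *)
Definition dominated (f : R -> C) (M : R) :=
  (forall t, continuous f t) /\ forall t, Cmod (f t) <= M / (1 + t ^ 2).

Lemma one_plus_sqr_pos (t : R) : 0 < 1 + t ^ 2.
Proof. generalize (pow2_ge_0 t); lra. Qed.

Lemma dominated_ge_0 (f : R -> C) (M : R) : dominated f M -> 0 <= M.
Proof.
  intros [_ H]; specialize (H 0); generalize (Cmod_ge_0 (f 0)).
  replace (M / (1 + 0 ^ 2)) with M in H by field; lra.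
Qed.

Lemma is_RInt_atan (M a b : R) :
  is_RInt (fun t => M / (1 + t ^ 2)) a b (M * atan b - M * atan a).
Proof.
  apply (is_RInt_derive (V := R_CompleteNormedModule) (fun t => M * atan t)).
  - intros x _; auto_derive; [trivial|]. unfold Rsqr; field.
    generalize (one_plus_sqr_pos x); simpl; lra.
  - intros x _; eapply continuous_real; auto_derive; [|reflexivity].
    generalize (one_plus_sqr_pos x); simpl; lra.
Qed.

Lemma filterlim_scal_real (F : (R -> Prop) -> Prop) (FF : Filter F) (f : R -> R) (k l : R) :
  filterlim f F (locally l) -> filterlim (fun x => k * f x) F (locally (k * l)).
Proof.
  intros H; apply filterlim_comp with (1 := H).
  exact (continuous_mult (K := R_AbsRing) _ _ _ (continuous_const k l) (continuous_id l)).
Qed.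

Lemma is_RInt_gen_atan (M : R) :
  is_RInt_gen (fun t => M / (1 + t ^ 2)) (Rbar_locally m_infty) (Rbar_locally p_infty) (M * PI).
Proof.
  replace (M * PI) with (minus (M * (PI / 2)) (M * (- (PI / 2))))
    by (unfold minus, plus, opp; simpl; field).
  apply (is_RInt_gen_primitive R_CompleteNormedModule) with (fun x => M * atan x).
  - intros x; generalize (is_RInt_atan M 0 x); rewrite atan_0.
    now replace (M * atan x - M * 0) with (M * atan x) by ring.
  - apply filterlim_scal_real, atan_lim_p; typeclasses eauto.
  - apply filterlim_scal_real, atan_lim_m; typeclasses eauto.
Qed.

Lemma ex_RInt_C (f : R -> C) (a b : R) :
  (forall t, continuous f t) -> ex_RInt (V := C_R_NormedModule) f a b.
Proof. intros H; apply (ex_RInt_continuous (V := C_R_CompleteNormedModule)); trivial. Qed.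

Notation RIntC := (RInt (V := C_R_CompleteNormedModule)).

Lemma is_RInt_C (f : R -> C) (a b : R) :
  (forall t, continuous f t) -> is_RInt (V := C_R_NormedModule) f a b (RIntC f a b).
Proof. intros H; apply (RInt_correct (V := C_R_CompleteNormedModule)), ex_RInt_C, H. Qed.

(** The increment of the integral between [u] and [v] is at most [M] times that of [atan], so the
    Cauchy property is inherited from [atan]. Dividing by [M + 1] rather than [M] covers [M = 0]. *)
Lemma dominated_cauchy (f : R -> C) (M : R) (F : (R -> Prop) -> Prop)
  (FF : ProperFilter F) (l : R) :
  dominated f M -> filterlim atan F (locally l) ->
  exists y : C, filterlim (fun x => RIntC f 0 x) F (locally y).
Proof.
  intros Hf Hl; assert (HM := dominated_ge_0 _ _ Hf); destruct Hf as [Hc Hb].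
  apply (filterlim_locally_cauchy (U := C_R_CompleteNormedModule)).
  intros eps.
  assert (He : 0 < eps / (M + 1)) by (apply Rdiv_lt_0_compat; [apply eps | lra]).
  destruct (proj2 (filterlim_locally_cauchy (U := R_CompleteSpace) atan)
    (ex_intro _ l Hl) (mkposreal _ He)) as [P [HP Hu]].
  exists P; split; [trivial|].
  assert (W : forall u v, P u -> P v -> u <= v ->
    Cmod (RIntC f 0 v - RIntC f 0 u)%C < eps).
  { intros u v Pu Pv Huv.
    assert (B : Cmod (RIntC f 0 v - RIntC f 0 u)%C <= M * atan v - M * atan u).
    { rewrite <- norm_C.
      refine (norm_RInt_le (V := C_R_NormedModule) f (fun t => M / (1 + t ^ 2)) u v _ _
        Huv _ _ (is_RInt_atan M u v)); [intros x _; rewrite norm_C; apply Hb |].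
      replace (RIntC f 0 v - RIntC f 0 u)%C with (- RIntC f 0 u + RIntC f 0 v)%C by ring.
      apply (is_RInt_Chasles (V := C_R_NormedModule)) with 0.
      - now apply (is_RInt_swap (V := C_R_NormedModule)), is_RInt_C.
      - now apply is_RInt_C. }
    specialize (Hu u v Pu Pv).
    change (Rabs (atan v - atan u) < eps / (M + 1)) in Hu.
    apply Rle_lt_trans with (1 := B).
    apply Rle_lt_trans with (M * (eps / (M + 1))).
    - generalize (Rle_abs (atan v - atan u)); nra.
    - apply Rlt_le_trans with ((M + 1) * (eps / (M + 1))); [nra|].
      right; field; lra. }
  intros u v Pu Pv.
  apply (norm_compat1 (V := C_R_NormedModule)); rewrite norm_C.
  change (Cmod (RIntC f 0 v - RIntC f 0 u)%C < eps).
  destruct (Rle_dec u v) as [H|H]; [now apply W|].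
  rewrite <- Cmod_opp; replace (- _)%C with (RIntC f 0 u - RIntC f 0 v)%C by ring.
  apply W; trivial; lra.
Qed.

Lemma ex_integral_R_dominated (f : R -> C) (M : R) : dominated f M -> ex_integral_R f.
Proof.
  intros Hf.
  destruct (dominated_cauchy f M (Rbar_locally p_infty) _ _ Hf atan_lim_p) as [l Hl].
  destruct (dominated_cauchy f M (Rbar_locally m_infty) _ _ Hf atan_lim_m) as [m Hm].
  exists (minus (G := C_R_NormedModule) l m).
  refine (is_RInt_gen_primitive C_R_CompleteNormedModule f _ l m _ Hl Hm).
  intros x; apply is_RInt_C, Hf.
Qed.

Definition is_integral_R (f : R -> C) (l : C) :=
  is_RInt_gen (V := C_R_NormedModule) f (Rbar_locally m_infty) (Rbar_locally p_infty) l.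

Lemma is_integral_R_dominated (f : R -> C) (M : R) :
  dominated f M -> is_integral_R f (integral_R f).
Proof.
  intros Hf.
  unfold is_integral_R, integral_R.
  exact (RInt_gen_correct (V := C_R_CompleteNormedModule) f
    (ex_integral_R_dominated f M Hf)).
Qed.

Lemma is_integral_R_unique (f : R -> C) (l : C) : is_integral_R f l -> integral_R f = l.
Proof.
  exact (is_RInt_gen_unique (V := C_R_CompleteNormedModule) f l).
Qed.

Lemma integral_R_ext (f g : R -> C) : (forall t, f t = g t) -> integral_R f = integral_R g.
Proof.
  intros H; unfold integral_R; f_equal.
  apply functional_extensionality, H.
Qed.

Lemma integral_R_bound (f : R -> C) (M : R) : dominated f M -> Cmod (integral_R f) <= M * PI.
Proof.
  intros Hf; rewrite <- norm_C.
  apply (RInt_gen_norm (V := C_R_CompleteNormedModule)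
    (Fa := Rbar_locally m_infty) (Fb := Rbar_locally p_infty) f (fun t => M / (1 + t ^ 2))).
  - exists (fun x => x < 0) (fun x => 0 < x); [now exists 0 | now exists 0 |].
    intros x y; simpl; lra.
  - apply filter_forall; intros ab x _; rewrite norm_C; apply Hf.
  - now apply is_integral_R_dominated with M.
  - apply is_RInt_gen_atan.
Qed.

Lemma integral_R_lim (f : R -> C) (M : R) :
  dominated f M ->
  filterlim (fun T => RIntC f (- T) T) (Rbar_locally p_infty) (locally (integral_R f)).
Proof.
  intros Hf P HP.
  destruct (is_integral_R_dominated f M Hf P HP) as [Q1 Q2 [m Hm] [p Hp] H].
  exists (Rmax p (- m)); intros T HT.
  assert (p < T /\ - m < T) as [H1 H2]
    by (generalize (Rmax_l p (- m)) (Rmax_r p (- m)); lra).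
  destruct (H (- T) T) as [y [Hy Py]]; [apply Hm; lra | apply Hp; lra |].
  simpl in Hy.
  replace (RIntC f (- T) T) with y; [trivial |].
  symmetry; exact (is_RInt_unique (V := C_R_CompleteNormedModule) f (- T) T y Hy).
Qed.

Lemma is_integral_R_plus (f g : R -> C) (l m : C) :
  is_integral_R f l -> is_integral_R g m -> is_integral_R (fun t => f t + g t)%C (l + m)%C.
Proof. exact (is_RInt_gen_plus (V := C_R_NormedModule) f g l m). Qed.

(** The integral lives in [C] as a real vector space, so a complex scalar has to be handled through
    real and imaginary parts. *)
Lemma is_RInt_Cscal (f : R -> C) (a b : R) (c l : C) :
  is_RInt (V := C_R_NormedModule) f a b l ->
  is_RInt (V := C_R_NormedModule) (fun t => c * f t)%C a b (c * l)%C.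
Proof.
  intros H.
  assert (H1 := is_RInt_fct_extend_fst (U := R_NormedModule) (V := R_NormedModule) _ _ _ _ H).
  assert (H2 := is_RInt_fct_extend_snd (U := R_NormedModule) (V := R_NormedModule) _ _ _ _ H).
  apply (is_RInt_fct_extend_pair (U := R_NormedModule) (V := R_NormedModule)).
  - exact (is_RInt_minus (V := R_NormedModule) _ _ _ _ _ _
      (is_RInt_scal (V := R_NormedModule) _ _ _ (fst c) _ H1)
      (is_RInt_scal (V := R_NormedModule) _ _ _ (snd c) _ H2)).
  - exact (is_RInt_plus (V := R_NormedModule) _ _ _ _ _ _
      (is_RInt_scal (V := R_NormedModule) _ _ _ (fst c) _ H2)
      (is_RInt_scal (V := R_NormedModule) _ _ _ (snd c) _ H1)).
Qed.

Lemma is_integral_R_Cscal (f : R -> C) (c l : C) :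
  is_integral_R f l -> is_integral_R (fun t => c * f t)%C (c * l)%C.
Proof.
  intros H P HP.
  assert (HC : continuous (fun z => c * z)%C l)
    by (apply continuous_Cmult; [apply continuous_const | apply continuous_id]).
  generalize (H _ (HC P HP)); unfold filtermapi; apply filter_imp.
  intros ab [y [H1 H2]]; exists (c * y)%C; split; [now apply is_RInt_Cscal | trivial].
Qed.

Lemma is_integral_R_comp_scale (f : R -> C) (k : R) (l : C) :
  0 < k -> is_integral_R f l -> is_integral_R (fun t => f (k * t)) (RtoC (/ k) * l)%C.
Proof.
  intros Hk H.
  assert (H' : is_integral_R (fun t => RtoC k * f (k * t)%R)%C l).
  { intros P HP; destruct (H P HP) as [Q1 Q2 [m Hm] [p Hp] HQ].
    exists (fun x => x < m / k) (fun x => p / k < x); [now exists (m / k) | now exists (p / k) |].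
    intros x y Hx Hy.
    destruct (HQ (k * x) (k * y)) as [z [Hz Pz]].
    - apply Hm; apply Rmult_lt_compat_l with (r := k) in Hx; trivial.
      replace (k * (m / k)) with m in Hx by (field; lra); trivial.
    - apply Hp; apply Rmult_lt_compat_l with (r := k) in Hy; trivial.
      replace (k * (p / k)) with p in Hy by (field; lra); trivial.
    - exists z; split; [|trivial].
      simpl in *; replace (k * x) with (k * x + 0) in Hz by ring.
      replace (k * y) with (k * y + 0) in Hz by ring.
      apply (is_RInt_comp_lin (V := C_R_NormedModule)) in Hz.
      revert Hz; apply is_RInt_ext; intros t _.
      rewrite Rplus_0_r; destruct (f (k * t)).
      change ((k * r, k * r0) = (RtoC k * (r, r0))%C).
      apply C_ext; simpl; ring. }
  apply (is_integral_R_Cscal _ (RtoC (/ k))) in H'.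
  replace (fun t => f (k * t)) with (fun t => RtoC (/ k) * (RtoC k * f (k * t)%R))%C; [trivial|].
  apply functional_extensionality; intros t.
  rewrite Cmult_assoc, <- RtoC_mult, Rinv_l, Cmult_1_l; [reflexivity | lra].
Qed.

Lemma filterlim_0_bound (f : R -> C) (M : R) :
  (forall t, Cmod (f t) <= M / (1 + t ^ 2)) ->
  filterlim f (Rbar_locally p_infty) (locally (RtoC 0)) /\
  filterlim f (Rbar_locally m_infty) (locally (RtoC 0)).
Proof.
  intros H.
  assert (HM : 0 <= M).
  { specialize (H 0); generalize (Cmod_ge_0 (f 0)).
    replace (M / (1 + 0 ^ 2)) with M in H by field; lra. }
  (* The [+ 1] in the threshold forces [Rabs t > 1], so that [t ^ 2] dominates [Rabs t]. *)
  assert (A : forall eps : posreal, forall t, (M + 1) / eps + 1 < Rabs t ->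
    ball (M := C_R_NormedModule) (RtoC 0) eps (f t)).
  { intros eps t Ht; apply (norm_compat1 (V := C_R_NormedModule)); rewrite norm_C.
    change (Cmod (f t - RtoC 0)%C < eps).
    replace (f t - RtoC 0)%C with (f t) by ring.
    apply Rle_lt_trans with (1 := H t).
    assert (He := cond_pos eps).
    assert (0 < (M + 1) / eps) by (apply Rdiv_lt_0_compat; lra).
    apply Rmult_lt_reg_r with (1 + t ^ 2); [apply one_plus_sqr_pos|].
    replace (M / (1 + t ^ 2) * (1 + t ^ 2)) with M
      by (field; apply Rgt_not_eq, one_plus_sqr_pos).
    assert (E : t ^ 2 = Rabs t ^ 2) by (now rewrite pow2_abs).
    rewrite E.
    assert ((M + 1) / eps < Rabs t ^ 2) by nra.
    assert (M + 1 < Rabs t ^ 2 * eps).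
    { apply Rmult_lt_reg_r with (/ eps); [now apply Rinv_0_lt_compat|].
      replace (Rabs t ^ 2 * eps * / eps) with (Rabs t ^ 2) by (field; lra); trivial. }
    nra. }
  split; apply (filterlim_locally (U := C_R_NormedModule)); intros eps.
  - exists ((M + 1) / eps + 1); intros t Ht; apply A.
    generalize (Rle_abs t); lra.
  - exists (- ((M + 1) / eps + 1)); intros t Ht; apply A.
    generalize (Rle_abs (- t)); rewrite Rabs_Ropp; lra.
Qed.

Lemma is_RInt_Cderiv (g g' : R -> C) (a b : R) :
  (forall t, Cderiv g t (g' t)) -> (forall t, continuous g' t) ->
  is_RInt (V := C_R_NormedModule) g' a b (g b - g a)%C.
Proof.
  intros Hd Hc.
  apply (is_RInt_fct_extend_pair (U := R_NormedModule) (V := R_NormedModule)).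
  - apply (is_RInt_derive (V := R_CompleteNormedModule) (fun t => Re (g t))).
    + intros x _; apply Hd.
    + intros x _; apply (continuous_Re _ g'), Hc.
  - apply (is_RInt_derive (V := R_CompleteNormedModule) (fun t => Im (g t))).
    + intros x _; apply Hd.
    + intros x _; apply (continuous_Im _ g'), Hc.
Qed.

Lemma is_integral_R_derive (g g' : R -> C) (M : R) :
  (forall t, Cderiv g t (g' t)) -> (forall t, continuous g' t) ->
  (forall t, Cmod (g t) <= M / (1 + t ^ 2)) ->
  is_integral_R g' (RtoC 0).
Proof.
  intros Hd Hc Hb.
  destruct (filterlim_0_bound g M Hb) as [Hp Hm].
  assert (HC : forall l : C, l = RtoC 0 -> forall F : (R -> Prop) -> Prop, Filter F ->
    filterlim g F (locally l) -> filterlim (fun x => g x - g 0)%C F (locally (- g 0)%C)).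
  { intros l -> F FF HF.
    replace (- g 0)%C with (RtoC 0 - g 0)%C by ring.
    apply (filterlim_comp _ _ _ g (fun z => z - g 0)%C F _ _ HF).
    apply continuous_Cplus; [apply continuous_id | apply continuous_const]. }
  replace (RtoC 0) with (minus (G := C_R_NormedModule) (- g 0)%C (- g 0)%C)
    by apply (minus_eq_zero (G := C_R_NormedModule)).
  refine (is_RInt_gen_primitive C_R_CompleteNormedModule g' (fun x => g x - g 0)%C _ _ _ _ _).
  - intros x; exact (is_RInt_Cderiv g g' 0 x Hd Hc).
  - exact (HC _ eq_refl _ _ Hp).
  - exact (HC _ eq_refl _ _ Hm).
Qed.

(** * Independence of the vertical line *)

Lemma Cderiv_hline (t x : R) : Cderiv (fun u => (u, t)) x (RtoC 1).
Proof.
  split; simpl; [apply (is_derive_id (K := R_AbsRing)) |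
                 apply (is_derive_const (V := R_NormedModule))].
Qed.

Lemma Cderiv_vline (s x : R) : Cderiv (fun u => (s, u)) x Ci.
Proof.
  split; simpl; [apply (is_derive_const (V := R_NormedModule)) |
                 apply (is_derive_id (K := R_AbsRing))].
Qed.

Lemma continuous_vline (F : C -> C) (s t : R) :
  continuous F (s, t) -> continuous (fun u => F (s, u)) t.
Proof.
  intros H; apply (continuous_comp (fun u => (s, u)) F); [|exact H].
  exact (Cderiv_continuous _ _ _ (Cderiv_vline s t)).
Qed.

Lemma hol_continuous_vline (F F' : C -> C) (s t : R) :
  hol F F' (s, t) -> continuous (fun u => F (s, u)) t.
Proof.
  intros H; eapply Cderiv_continuous, (H (fun u => (s, u)) t Ci eq_refl), Cderiv_vline.
Qed.

Lemma locally_between (p q x : R) : p < x < q -> locally x (fun y => p < y < q).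
Proof.
  intros H.
  apply (locally_interval _ x p q); simpl; try tauto; try lra.
Qed.

Lemma is_derive_Re_sigma (F F' : C -> C) (p q x t : R) :
  (forall w, p < Re w < q -> hol F F' w) ->
  p < x < q -> is_derive (fun u => Re (F (u, t))) x (Re (F' (x, t))).
Proof.
  intros HF Hx.
  destruct (HF (x, t) Hx (fun u => (u, t)) x _ eq_refl (Cderiv_hline t x)) as [H _].
  now rewrite Cmult_1_r in H.
Qed.

Lemma is_RInt_Re_t (F F' : C -> C) (p q x a b : R) :
  (forall w, p < Re w < q -> hol F F' w) ->
  (forall w, p < Re w < q -> continuous F' w) ->
  p < x < q ->
  is_RInt (fun t => Re (F' (x, t))) a b (Im (F (x, b)) - Im (F (x, a))).
Proof.
  intros HF HF' Hx.
  apply (is_RInt_derive (V := R_CompleteNormedModule) (fun t => Im (F (x, t)))).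
  - intros t _.
    destruct (HF (x, t) Hx (fun u => (x, u)) t _ eq_refl (Cderiv_vline x t)) as [_ H].
    evar_last; [exact H | simpl; unfold Re, Im; ring].
  - intros t _; apply (continuous_Re _ (fun t => F' (x, t))), continuous_vline, HF', Hx.
Qed.

Lemma ex_RInt_Re (F F' : C -> C) (p q x a b : R) :
  (forall w, p < Re w < q -> hol F F' w) ->
  p < x < q -> ex_RInt (fun t => Re (F (x, t))) a b.
Proof.
  intros HF Hx; apply (ex_RInt_continuous (V := R_CompleteNormedModule)).
  intros t _; apply (continuous_Re _ (fun t => F (x, t))).
  eapply hol_continuous_vline, HF, Hx.
Qed.

(* Re F' is both the sigma-derivative of Re F and the t-derivative of Im F, so
   differentiating under the integral sign leaves only boundary terms. *)
Lemma is_derive_RInt_Re (F F' : C -> C) (p q x a b : R) :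
  (forall w, p < Re w < q -> hol F F' w) ->
  (forall w, p < Re w < q -> continuous F' w) ->
  p < x < q ->
  is_derive (fun u => RInt (fun t => Re (F (u, t))) a b) x (Im (F (x, b)) - Im (F (x, a))).
Proof.
  intros HF HF' Hx.
  assert (L := locally_between p q x Hx).
  evar_last.
  - apply is_derive_RInt_param.
    + revert L; apply filter_imp; intros y Hy t _.
      eexists; now apply (is_derive_Re_sigma F F' p q).
    + intros t _.
      apply continuity_2d_pt_ext_loc with (fun u v => Re (F' (u, v))).
      * destruct L as [eps L]; exists eps; intros u v Hu _.
        symmetry; apply is_derive_unique, (is_derive_Re_sigma F F' p q); [exact HF | apply L, Hu].
      * apply continuity_2d_pt_filterlim.
        apply filterlim_ext with (fun z : C => Re (F' z)); [now intros [] |].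
        apply (continuous_Re _ F'), HF', Hx.
    + revert L; apply filter_imp; intros y Hy; now apply (ex_RInt_Re F F' p q).
  - apply is_RInt_unique.
    apply is_RInt_ext with (fun t => Re (F' (x, t))); [|now apply (is_RInt_Re_t F F' p q)].
    intros t _; symmetry; now apply is_derive_unique, (is_derive_Re_sigma F F' p q).
Qed.

(** Mean value theorem in the abscissa: the derivative of the truncated integral consists of the two
    edge terms bounded by [K]. *)
Lemma RInt_Re_shift (F F' : C -> C) (p q a b T K : R) :
  (forall w, p < Re w < q -> hol F F' w) ->
  (forall w, p < Re w < q -> continuous F' w) ->
  p < a -> a <= b -> b < q ->
  (forall x, a <= x <= b -> Rabs (Im (F (x, T)) - Im (F (x, - T))) <= K) ->
  Rabs (RInt (fun t => Re (F (b, t))) (- T) T - RInt (fun t => Re (F (a, t))) (- T) T)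
    <= K * (b - a).
Proof.
  intros HF HF' Ha Hab Hb HK.
  destruct (MVT_gen (fun u => RInt (fun t => Re (F (u, t))) (- T) T) a b
    (fun x => Im (F (x, T)) - Im (F (x, - T)))) as [c [Hc E]].
  - intros x; rewrite Rmin_left, Rmax_right by trivial; intros Hx.
    apply (is_derive_RInt_Re F F' p q); trivial; lra.
  - intros x; rewrite Rmin_left, Rmax_right by trivial; intros Hx.
    apply continuity_pt_filterlim.
    apply (ex_derive_continuous (V := R_NormedModule)
      (fun u => RInt (fun t => Re (F (u, t))) (- T) T)).
    eexists; apply (is_derive_RInt_Re F F' p q); trivial; lra.
  - rewrite Rmin_left, Rmax_right in Hc by trivial.
    rewrite E, Rabs_mult, (Rabs_pos_eq (b - a)) by lra.
    apply Rmult_le_compat_r; [lra | auto].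
Qed.

Lemma RIntC_parts (f : R -> C) (a b : R) :
  (forall t, continuous f t) ->
  RIntC f a b = (RInt (fun t => Re (f t)) a b, RInt (fun t => Im (f t)) a b).
Proof.
  intros Hf; assert (H := is_RInt_C f a b Hf).
  assert (H1 := is_RInt_fct_extend_fst (U := R_NormedModule) (V := R_NormedModule) _ _ _ _ H).
  assert (H2 := is_RInt_fct_extend_snd (U := R_NormedModule) (V := R_NormedModule) _ _ _ _ H).
  apply C_ext; symmetry; simpl;
    [exact (is_RInt_unique _ _ _ _ H1) | exact (is_RInt_unique _ _ _ _ H2)].
Qed.

Lemma hol_Cscal (c : C) (F F' : C -> C) (w : C) :
  hol F F' w -> hol (fun w => c * F w)%C (fun w => c * F' w)%C w.
Proof.
  intros HF g x d Hg Hd.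
  generalize (hol_mult _ _ _ _ w (hol_const c w) HF g x d Hg Hd).
  apply Cderiv_ext; [trivial | ring].
Qed.

(** Cauchy's theorem on the rectangle of height [2 * T], whose horizontal edges fade as [T] grows.
    The uniform bound on the strip is asked for only from height [T0] on, where the denominator of
    the kernel is easily controlled. *)
Lemma contour_shift (F F' : C -> C) (p q a b M H T0 : R) :
  (forall w, p < Re w < q -> hol F F' w) ->
  (forall w, p < Re w < q -> continuous F' w) ->
  p < a -> a <= b -> b < q ->
  (forall x t, a <= x <= b -> T0 <= Rabs t -> Cmod (F (x, t)) <= H / (1 + t ^ 2)) ->
  dominated (fun t => F (a, t)) M -> dominated (fun t => F (b, t)) M ->
  integral_R (fun t => F (a, t)) = integral_R (fun t => F (b, t)).
Proof.
  intros HF HF' Ha Hab Hb HH Da Db.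
  assert (La := integral_R_lim _ _ Da); assert (Lb := integral_R_lim _ _ Db).
  set (D := fun T => (RIntC (fun t => F (b, t)) (- T) T - RIntC (fun t => F (a, t)) (- T) T)%C).
  assert (LD : filterlim D (Rbar_locally p_infty)
    (locally (integral_R (fun t => F (b, t)) - integral_R (fun t => F (a, t)))%C)).
  { exact (filterlim_comp_2 _ _ (plus (G := C_R_NormedModule)) Lb
      (filterlim_comp _ _ _ _ _ _ _ _ La (filterlim_opp (V := C_R_NormedModule) _))
      (filterlim_plus (V := C_R_NormedModule) _ _)). }
  (* [Im F] is the real part of [- Ci * F], so the result for real parts, applied to this multiple,
     yields the imaginary part. *)
  assert (HF2 : forall w, p < Re w < q ->
    hol (fun w => - Ci * F w)%C (fun w => - Ci * F' w)%C w).
  { intros w Hw; now apply hol_Cscal, HF. }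
  assert (HF2' : forall w, p < Re w < q -> continuous (fun w => - Ci * F' w)%C w).
  { intros w Hw; apply continuous_Cmult; [apply continuous_const | now apply HF']. }
  assert (HDb : forall T, Rmax 0 T0 <= T ->
    Cmod (D T) <= 4 * Rabs H * (b - a) / (1 + T ^ 2)).
  { intros T HT.
    assert (HT0 : 0 <= T) by (apply Rle_trans with (2 := HT), Rmax_l).
    assert (HT1 : T0 <= T) by (apply Rle_trans with (2 := HT), Rmax_r).
    assert (B : forall x, a <= x <= b ->
      Cmod (F (x, T)) <= Rabs H / (1 + T ^ 2) /\ Cmod (F (x, - T)) <= Rabs H / (1 + T ^ 2)).
    { intros x Hx.
      assert (H / (1 + T ^ 2) <= Rabs H / (1 + T ^ 2)).
      { apply Rmult_le_compat_r; [|apply Rle_abs].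
        apply Rlt_le, Rinv_0_lt_compat, one_plus_sqr_pos. }
      split; apply Rle_trans with (2 := H0).
      - apply HH; trivial; now rewrite Rabs_pos_eq.
      - replace (1 + T ^ 2) with (1 + (- T) ^ 2) by ring.
        apply HH; trivial; now rewrite Rabs_Ropp, Rabs_pos_eq. }
    unfold D; rewrite !RIntC_parts by (apply Da || apply Db).
    apply Rle_trans with (1 := Cmod_le_sum _).
    replace (4 * Rabs H * (b - a) / (1 + T ^ 2)) with
      (2 * (Rabs H / (1 + T ^ 2)) * (b - a) + 2 * (Rabs H / (1 + T ^ 2)) * (b - a))
      by (field; apply Rgt_not_eq, one_plus_sqr_pos).
    apply Rplus_le_compat.
    - apply (RInt_Re_shift F F' p q _ _ _ _ HF HF'); trivial.
      intros x Hx; destruct (B x Hx) as [B1 B2].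
      apply Rle_trans with (1 := Rabs_triang _ _); rewrite Rabs_Ropp.
      generalize (Cmod_ge_Im (F (x, T))) (Cmod_ge_Im (F (x, - T))); lra.
    - assert (E : forall x, RInt (fun t => Im (F (x, t))) (- T) T =
        RInt (fun t => Re (- Ci * F (x, t))%C) (- T) T).
      { intros x; apply RInt_ext; intros t _; simpl; unfold Re, Im; ring. }
      simpl Im; rewrite !E.
      apply (RInt_Re_shift _ _ p q _ _ _ _ HF2 HF2'); trivial.
      intros x Hx; destruct (B x Hx) as [B1 B2].
      assert (G : forall z, Im (- Ci * z)%C = - Re z) by (intros z; simpl; unfold Re, Im; ring).
      rewrite !G.
      generalize (Cmod_ge_Re (F (x, T))) (Cmod_ge_Re (F (x, - T))).
      unfold Rabs at 1 2; intros K1 K2; apply Rabs_le; revert K1 K2.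
      do 2 destruct Rcase_abs; lra. }
  set (K := 4 * Rabs H * (b - a)) in HDb.
  (* The decay lemma asks for its bound at every real number, whereas [HDb] starts at [Rmax 0 T0];
     below that point [D] is replaced by 0. *)
  set (g := fun T => if Rle_dec (Rmax 0 T0) T then D T else RtoC 0).
  assert (Lg : filterlim g (Rbar_locally p_infty) (locally (RtoC 0))).
  { apply (filterlim_0_bound g K); intros t; unfold g; destruct Rle_dec; [now apply HDb|].
    rewrite Cmod_0; apply Rmult_le_pos.
    - unfold K; generalize (Rabs_pos H); nra.
    - apply Rlt_le, Rinv_0_lt_compat, one_plus_sqr_pos. }
  assert (Lg' : filterlim D (Rbar_locally p_infty) (locally (RtoC 0))).
  { revert Lg; apply filterlim_ext_loc; exists (Rmax 0 T0); intros t Ht.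
    unfold g; destruct Rle_dec; [reflexivity | lra]. }
  assert (E := filterlim_locally_unique (V := C_R_NormedModule) _ _ _ Lg' LD).
  apply C_ext; [apply (f_equal Re) in E | apply (f_equal Im) in E];
    simpl in *; unfold Re, Im in *; lra.
Qed.

(** * The integrands *)

(** This class is stable under multiplication by functions of growth [exp (A' + B' * Rabs t)], with
    the same [beta]. Powers of [w], Taylor terms and exponentials of the logarithm are all of that
    growth. *)
Definition gaussian (f : R -> C) (A B beta : R) :=
  (forall t, continuous f t) /\
  forall t, Cmod (f t) <= exp (A + B * Rabs t - beta * t ^ 2).

(** Completing the square gives the maximum of [A + (B + 1) * x - beta * x ^ 2]. The extra 1 beside
    [B] and the factor 2 come from [1 + x ^ 2 <= 2 * exp x]. *)
Definition gauss_const (A B beta : R) := 2 * exp (A + (B + 1) ^ 2 / (4 * beta)).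

Lemma exp_mono (x y : R) : x <= y -> exp x <= exp y.
Proof. intros [H | ->]; [now apply Rlt_le, exp_increasing | apply Rle_refl]. Qed.

Lemma exp_ge_quad (x : R) : 0 <= x -> 1 + x ^ 2 <= 2 * exp x.
Proof.
  intros Hx.
  assert (H : (1 + x / 2) ^ 2 <= exp x).
  { replace x with (x / 2 + x / 2) at 2 by field.
    rewrite exp_plus; generalize (exp_ineq1_le (x / 2)); nra. }
  (* The square of [1 + x / 2] suffices only slightly beyond 4; further out the fourth power of
     [1 + x / 4] takes over. *)
  destruct (Rle_dec x 4) as [H4 | H4].
  - nra.
  - assert (H' : (1 + x / 4) ^ 4 <= exp x).
    { replace x with (x / 4 + x / 4 + (x / 4 + x / 4)) at 2 by field.
      rewrite !exp_plus. assert (K := exp_ineq1_le (x / 4)).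
      assert (0 < 1 + x / 4) by lra.
      assert ((1 + x / 4) ^ 2 <= exp (x / 4) ^ 2) by (apply pow_incr; lra).
      generalize (pow2_ge_0 (1 + x / 4)); nra. }
    assert (2 <= 1 + x / 4) by lra.
    assert (4 <= (1 + x / 4) ^ 2) by nra.
    nra.
Qed.

Lemma gauss_le (A B beta t : R) :
  0 < beta ->
  exp (A + B * Rabs t - beta * t ^ 2) <= gauss_const A B beta / (1 + t ^ 2).
Proof.
  intros Hb.
  apply Rmult_le_reg_r with (1 + t ^ 2); [apply one_plus_sqr_pos|].
  replace (gauss_const A B beta / (1 + t ^ 2) * (1 + t ^ 2)) with (gauss_const A B beta)
    by (field; apply Rgt_not_eq, one_plus_sqr_pos).
  rewrite <- (pow2_abs t); set (x := Rabs t).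
  assert (Hx : 0 <= x) by apply Rabs_pos.
  apply Rle_trans with (exp (A + B * x - beta * x ^ 2) * (2 * exp x)).
  - apply Rmult_le_compat_l; [apply Rlt_le, exp_pos | now apply exp_ge_quad].
  - replace (_ * (2 * exp x)) with (2 * exp (A + B * x - beta * x ^ 2 + x))
      by (rewrite exp_plus; ring).
    unfold gauss_const; apply Rmult_le_compat_l; [lra|]; apply exp_mono.
    assert (E : (B + 1) ^ 2 / (4 * beta) - ((B + 1) * x - beta * x ^ 2) =
      (2 * beta * x - (B + 1)) ^ 2 / (4 * beta)) by (field; lra).
    assert (0 <= (2 * beta * x - (B + 1)) ^ 2 / (4 * beta)).
    { apply Rmult_le_pos; [apply pow2_ge_0 | apply Rlt_le, Rinv_0_lt_compat; lra]. }
    lra.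
Qed.

Lemma gaussian_dominated (f : R -> C) (A B beta : R) :
  0 < beta -> gaussian f A B beta -> dominated f (gauss_const A B beta).
Proof.
  intros Hb [Hc Hf]; split; [trivial|]; intros t.
  apply Rle_trans with (1 := Hf t), gauss_le, Hb.
Qed.

(** * The common kernel and the zeros of its denominator *)

Definition den (eps : R) (w : C) : C := (1 - RtoC eps * Cexp (w * w))%C.

(** Power and exponential share one [Cexp]: the modulus is read off a single real part, and a change
    of [z] or [alpha] is a further exponential factor. *)
Definition kern (eps alpha : R) (z w : C) : C :=
  (Cexp (2 * z * Clog w + RtoC alpha * (w * w)) * / den eps w)%C.

Definition nz (eps sigma : R) := forall t, den eps (sigma, t) <> RtoC 0.

(** Differentiating under the integral sign requires a derivative continuous in the plane; [hol]
    speaks of curves only, so both continuities are carried along. *)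
Definition hol_C1 (F F' : C -> C) (w : C) :=
  hol F F' w /\ continuous F w /\ continuous F' w.

Lemma hol_C1_const (c w : C) : hol_C1 (fun _ => c) (fun _ => RtoC 0) w.
Proof. split; [apply hol_const | split; apply continuous_const]. Qed.

Lemma hol_C1_id (w : C) : hol_C1 (fun w => w) (fun _ => RtoC 1) w.
Proof. split; [apply hol_id | split; [apply continuous_id | apply continuous_const]]. Qed.

Lemma hol_C1_plus (F F' G G' : C -> C) (w : C) :
  hol_C1 F F' w -> hol_C1 G G' w -> hol_C1 (fun w => F w + G w)%C (fun w => F' w + G' w)%C w.
Proof.
  intros (H1 & H2 & H3) (H4 & H5 & H6).
  split; [now apply hol_plus | split; now apply continuous_Cplus].
Qed.

Lemma hol_C1_mult (F F' G G' : C -> C) (w : C) :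
  hol_C1 F F' w -> hol_C1 G G' w ->
  hol_C1 (fun w => F w * G w)%C (fun w => F' w * G w + F w * G' w)%C w.
Proof.
  intros (H1 & H2 & H3) (H4 & H5 & H6).
  split; [now apply hol_mult | split; [now apply continuous_Cmult|]].
  apply continuous_Cplus; now apply continuous_Cmult.
Qed.

Lemma hol_C1_Cexp (F F' : C -> C) (w : C) :
  hol_C1 F F' w -> hol_C1 (fun w => Cexp (F w)) (fun w => F' w * Cexp (F w))%C w.
Proof.
  intros (H1 & H2 & H3).
  assert (H4 : continuous (fun w => Cexp (F w)) w)
    by (apply (continuous_comp F Cexp); [trivial | apply continuous_Cexp]).
  split; [now apply hol_Cexp | split; [trivial | now apply continuous_Cmult]].
Qed.

Lemma hol_C1_inv (F F' : C -> C) (w : C) :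
  F w <> RtoC 0 -> hol_C1 F F' w ->
  hol_C1 (fun w => / F w)%C (fun w => (- (1)) * F' w * (/ F w * / F w))%C w.
Proof.
  intros H0 (H1 & H2 & H3).
  assert (H4 : continuous (fun w => / F w)%C w)
    by (apply (continuous_comp F Cinv); [trivial | now apply continuous_Cinv]).
  split; [|split; [trivial|]].
  - intros g x d Hg Hd; generalize (hol_inv _ _ _ H0 H1 g x d Hg Hd).
    apply Cderiv_ext; [trivial | ring].
  - exact (continuous_Cmult _ _ _ _
      (continuous_Cmult _ _ _ _ (continuous_const _ _) H3) (continuous_Cmult _ _ _ _ H4 H4)).
Qed.

Lemma Re_pos_neq_0 (w : C) : 0 < Re w -> w <> RtoC 0.
Proof. intros H E; rewrite E in H; simpl in H; lra. Qed.

Lemma hol_C1_Clog (w : C) : 0 < Re w -> hol_C1 Clog Cinv w.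
Proof.
  intros H; split; [now apply hol_Clog | split; [now apply continuous_Clog|]].
  now apply continuous_Cinv, Re_pos_neq_0.
Qed.

(** The derivative is assembled by unification. A single [F'] serves every admissible point, as
    [contour_shift] requires. *)
Lemma kern_hol_C1 (eps alpha : R) (z : C) :
  exists F', forall w, 0 < Re w -> den eps w <> RtoC 0 -> hol_C1 (kern eps alpha z) F' w.
Proof.
  eexists; intros w Hw Hd.
  apply hol_C1_mult.
  - apply hol_C1_Cexp, hol_C1_plus; apply hol_C1_mult.
    + apply hol_C1_const.
    + apply hol_C1_Clog, Hw.
    + apply hol_C1_const.
    + apply hol_C1_mult; apply hol_C1_id.
  - apply hol_C1_inv; [exact Hd|].
    apply hol_C1_plus; [apply hol_C1_const|].
    eassert (E : hol_C1 (fun w => - (1) * (RtoC eps * Cexp (w * w)))%C _ w).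
    { apply hol_C1_mult; [apply hol_C1_const|].
      apply hol_C1_mult; [apply hol_C1_const|].
      apply hol_C1_Cexp, hol_C1_mult; apply hol_C1_id. }
    (* The opposite is rewritten as multiplication by a constant, to which the product rule
       applies. *)
    replace (fun w => - (RtoC eps * Cexp (w * w)))%C with
      (fun w => - (1) * (RtoC eps * Cexp (w * w)))%C; [exact E|].
    apply functional_extensionality; intros u; ring.
Qed.

Lemma kern_continuous (eps alpha sigma : R) (z : C) (t : R) :
  0 < sigma -> nz eps sigma -> continuous (fun t => kern eps alpha z (sigma, t)) t.
Proof.
  intros Hs Hn; destruct (kern_hol_C1 eps alpha z) as [F' HF].
  apply continuous_vline, (HF (sigma, t) Hs (Hn t)).
Qed.

Lemma Re_sqr (x t : R) : Re ((x, t) * (x, t))%C = x ^ 2 - t ^ 2.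
Proof. simpl; ring. Qed.

(** The exponential has modulus [exp (x ^ 2 - t ^ 2) <= exp (-1) <= / 2]. *)
Lemma den_tail (eps x t : R) :
  Rabs eps <= 1 -> x ^ 2 + 1 <= t ^ 2 -> / 2 <= Cmod (den eps (x, t)).
Proof.
  intros He Ht; unfold den.
  assert (H := Cmod_triangle (1 - RtoC eps * Cexp ((x, t) * (x, t)))
    (RtoC eps * Cexp ((x, t) * (x, t)))).
  replace (1 - _ + _)%C with (RtoC 1) in H by ring.
  rewrite Cmod_1, Cmod_mult, Cmod_R, Cmod_Cexp, Re_sqr in H.
  assert (exp (x ^ 2 - t ^ 2) <= / 2).
  { apply Rle_trans with (exp (- (1))); [apply exp_mono; lra|].
    rewrite exp_Ropp; apply Rinv_le_contravar; [lra|].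
    generalize (exp_ineq1_le 1); lra. }
  generalize (exp_pos (x ^ 2 - t ^ 2)) (Rabs_pos eps); nra.
Qed.

Lemma nz_0 (sigma : R) : nz 0 sigma.
Proof.
  intros t; unfold den; replace (1 - _)%C with (RtoC 1) by ring.
  intros E; apply RtoC_inj in E; lra.
Qed.

(** At a zero of [den] the exponential has modulus 1, which forces [t ^ 2 = sigma ^ 2]; then [w * w]
    is purely imaginary, equal to [2 * sigma ^ 2] up to sign times [Ci]. Comparing real parts gives
    the excluded equation. The bounds [sqrt PI] and [sqrt (PI / 2)] come from here. *)
Lemma nz_unit (eps sigma : R) :
  Rabs eps = 1 -> 0 < sigma -> eps * cos (2 * sigma ^ 2) <> 1 -> nz eps sigma.
Proof.
  intros He Hs Hc t E; apply Hc; unfold den in E.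
  assert (E1 : (RtoC eps * Cexp ((sigma, t) * (sigma, t)))%C = RtoC 1).
  { replace (RtoC 1) with ((1 - RtoC eps * Cexp ((sigma, t) * (sigma, t)))
      + RtoC eps * Cexp ((sigma, t) * (sigma, t)))%C by ring.
    rewrite E; ring. }
  assert (E2 : exp (sigma ^ 2 - t ^ 2) = 1).
  { apply (f_equal Cmod) in E1.
    rewrite Cmod_1, Cmod_mult, Cmod_R, Cmod_Cexp, Re_sqr, He in E1; lra. }
  assert (E3 : sigma ^ 2 - t ^ 2 = 0).
  { apply exp_inv; now rewrite E2, exp_0. }
  apply (f_equal Re) in E1; unfold Cexp in E1; rewrite Re_sqr, E2 in E1.
  simpl in E1; rewrite <- E1.
  assert (Ht : t = sigma \/ t = - sigma).
  { assert ((t - sigma) * (t + sigma) = 0) by nra.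
    apply Rmult_integral in H; destruct H; [left | right]; lra. }
  replace (cos (sigma * t + t * sigma)) with (cos (2 * sigma ^ 2)); [ring|].
  destruct Ht as [-> | ->]; [f_equal; ring|].
  rewrite <- cos_neg; f_equal; ring.
Qed.

Lemma sqr_lt_of_lt_sqrt (x y : R) : 0 < y -> 0 < x < sqrt y -> 0 < x ^ 2 < y.
Proof.
  intros Hy Hx; split; [nra|].
  rewrite <- (sqrt_sqrt y) by lra; nra.
Qed.

Lemma nz_1 (sigma : R) : 0 < sigma < sqrt PI -> nz 1 sigma.
Proof.
  intros Hs; apply nz_unit; [apply Rabs_R1 | lra |].
  apply (sqr_lt_of_lt_sqrt _ _ PI_RGT_0) in Hs.
  rewrite cos_2a_sin.
  assert (0 < sin (sigma ^ 2)) by (apply sin_gt_0; lra); nra.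
Qed.

Lemma nz_m1 (sigma : R) : 0 < sigma < sqrt (PI / 2) -> nz (-1) sigma.
Proof.
  assert (HP := PI_RGT_0).
  intros Hs; apply nz_unit; [unfold Rabs; destruct Rcase_abs; lra | lra |].
  apply sqr_lt_of_lt_sqrt in Hs; [|lra].
  rewrite cos_2a_cos.
  assert (0 < cos (sigma ^ 2)) by (apply cos_gt_0; lra); nra.
Qed.

(** Compactness on [[- T, T]], where a nonvanishing continuous function attains a positive minimum,
    and [den_tail] outside. *)
Lemma den_lower_bound (eps sigma : R) :
  Rabs eps <= 1 -> nz eps sigma ->
  exists c, 0 < c /\ forall t, c <= Cmod (den eps (sigma, t)).
Proof.
  intros He Hn.
  assert (Hc : forall t, continuity_pt (fun t => Cmod (den eps (sigma, t))) t).
  { intros t; apply continuity_pt_filterlim.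
    assert (K : continuous (fun t => den eps (sigma, t)) t).
    { apply (continuous_vline (den eps)); unfold den.
      apply (continuous_minus (V := C_R_NormedModule)); [apply continuous_const|].
      apply continuous_Cmult; [apply continuous_const|].
      apply (continuous_comp (fun w => w * w)%C Cexp); [|apply continuous_Cexp].
      apply continuous_Cmult; apply continuous_id. }
    apply (filterlim_ext (fun t => norm (V := C_R_NormedModule) (den eps (sigma, t)))).
    { intros u; apply norm_C. }
    rewrite <- norm_C.
    exact (filterlim_comp _ _ _ _ _ _ _ _ K (filterlim_norm (V := C_R_NormedModule) _)). }
  set (T := Rabs sigma + 1).
  assert (HT : 0 < T) by (unfold T; generalize (Rabs_pos sigma); lra).
  destruct (continuity_ab_min (fun t => Cmod (den eps (sigma, t))) (- T) T) as [m [Hm _]];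
    [lra | auto |].
  exists (Rmin (/ 2) (Cmod (den eps (sigma, m)))); split.
  - apply Rmin_glb_lt; [lra|]; apply Cmod_gt_0, Hn.
  - intros t; destruct (Rle_dec (Rabs t) T) as [Ht | Ht].
    + apply Rle_trans with (1 := Rmin_r _ _), Hm, Rabs_le_between, Ht.
    + apply Rle_trans with (1 := Rmin_l _ _), den_tail; [trivial|].
      rewrite <- (pow2_abs t), <- (pow2_abs sigma); unfold T in *.
      generalize (Rabs_pos sigma); nra.
Qed.

Lemma Re_le_Cmod (z : C) : Re z <= Cmod z.
Proof. apply Rle_trans with (1 := Rle_abs _), Cmod_ge_Re. Qed.

(** The right-hand side does not involve [x], so one Gaussian bound covers all lines [m <= x <= S].
    The bound [c] on the denominator is a parameter: it comes from [den_lower_bound] on one line and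
    from [den_tail] on a strip. *)
Lemma Cmod_kern_le (eps alpha m S c x t : R) (z : C) :
  0 < m <= x -> x <= S -> 0 <= alpha -> 0 < c <= Cmod (den eps (x, t)) ->
  Cmod (kern eps alpha z (x, t)) <=
  exp (2 * Cmod z * (Rabs (ln m) + 2 + S) + alpha * S ^ 2 - ln c + 2 * Cmod z * Rabs t
       - alpha * t ^ 2).
Proof.
  intros Hm HS Ha Hc; unfold kern.
  rewrite Cmod_mult, Cmod_inv, Cmod_Cexp by (apply Cmod_gt_0; lra).
  apply Rle_trans with
    (exp (2 * Cmod z * (Rabs (ln m) + 2 + S) + alpha * S ^ 2 + 2 * Cmod z * Rabs t
       - alpha * t ^ 2) * / c).
  - apply Rmult_le_compat; [apply Rlt_le, exp_pos | | | ].
    + apply Rlt_le, Rinv_0_lt_compat; lra.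
    + apply exp_mono.
      replace (Re (2 * z * Clog (x, t) + RtoC alpha * ((x, t) * (x, t))))%C with
        (Re (2 * z * Clog (x, t))%C + alpha * (x ^ 2 - t ^ 2)) by (simpl; ring).
      assert (H1 := Re_le_Cmod (2 * z * Clog (x, t))%C).
      rewrite !Cmod_mult in H1.
      replace (Cmod 2) with 2 in H1
        by (symmetry; rewrite Cmod_R; apply Rabs_pos_eq; lra).
      assert (H2 := Cmod_Clog_le (x, t) m Hm); simpl in H2.
      assert (Hz := Cmod_ge_0 z).
      assert (2 * Cmod z * Cmod (Clog (x, t)) <=
        2 * Cmod z * (Rabs (ln m) + 2 + S + Rabs t)) by (apply Rmult_le_compat_l; lra).
      assert (alpha * x ^ 2 <= alpha * S ^ 2)
        by (apply Rmult_le_compat_l; [trivial | apply pow_incr; lra]).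
      nra.
    + apply Rinv_le_contravar; lra.
  - right; rewrite <- (exp_ln c) at 1 by lra.
    rewrite <- exp_Ropp, <- exp_plus; f_equal; ring.
Qed.

Lemma kern_gaussian (eps alpha sigma : R) (z : C) :
  Rabs eps <= 1 -> 0 < sigma -> 0 <= alpha -> nz eps sigma ->
  exists A B, gaussian (fun t => kern eps alpha z (sigma, t)) A B alpha.
Proof.
  intros He Hs Ha Hn.
  destruct (den_lower_bound eps sigma He Hn) as [c [Hc Hd]].
  eexists; eexists; split; [intros t; now apply kern_continuous|].
  intros t; apply (Cmod_kern_le eps alpha sigma sigma c); trivial; lra || auto with real.
Qed.

Lemma kern_dominated (eps alpha sigma : R) (z : C) :
  Rabs eps <= 1 -> 0 < sigma -> 0 < alpha -> nz eps sigma ->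
  exists M, dominated (fun t => kern eps alpha z (sigma, t)) M.
Proof.
  intros He Hs Ha Hn.
  destruct (kern_gaussian eps alpha sigma z He Hs (Rlt_le _ _ Ha) Hn) as (A & B & H).
  eexists; apply gaussian_dominated with (2 := H), Ha.
Qed.

Definition Ikern (eps alpha sigma : R) (z : C) : C :=
  integral_R (fun t => kern eps alpha z (sigma, t)).

Lemma dominated_mono (f : R -> C) (M N : R) : M <= N -> dominated f M -> dominated f N.
Proof.
  intros H [Hc Hf]; split; [trivial|]; intros t; apply Rle_trans with (1 := Hf t).
  apply Rmult_le_compat_r; [|trivial].
  apply Rlt_le, Rinv_0_lt_compat, one_plus_sqr_pos.
Qed.

Lemma Ikern_shift (eps alpha q x y : R) (z : C) :
  Rabs eps <= 1 -> 0 < alpha -> (forall s, 0 < s < q -> nz eps s) ->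
  0 < x < q -> 0 < y < q -> Ikern eps alpha x z = Ikern eps alpha y z.
Proof.
  intros He Ha Hn.
  assert (W : forall x y, 0 < x -> x <= y -> y < q ->
    Ikern eps alpha x z = Ikern eps alpha y z).
  { clear x y; intros x y Hx Hxy Hy.
    destruct (kern_hol_C1 eps alpha z) as [F' HF].
    assert (HF1 : forall w, 0 < Re w < q -> hol_C1 (kern eps alpha z) F' w).
    { intros [u v] Hw; apply HF; [apply Hw | apply Hn, Hw]. }
    destruct (kern_dominated eps alpha x z He) as [M1 H1]; trivial; [apply Hn; lra|].
    destruct (kern_dominated eps alpha y z He) as [M2 H2]; trivial; [lra | apply Hn; lra |].
    (* From height [y + 1] on, [den_tail] bounds the denominator below by [/ 2] for every abscissa
       up to [y]. *)
    eapply (contour_shift (kern eps alpha z) F' 0 q x y (Rmax M1 M2) _ (y + 1)); trivial.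
    - intros w Hw; apply HF1, Hw.
    - intros w Hw; apply HF1, Hw.
    - intros s t Hs Ht.
      eapply Rle_trans; [apply (Cmod_kern_le eps alpha x y (/ 2)) | apply gauss_le, Ha]; try lra.
      split; [lra|]; apply den_tail; [trivial|].
      rewrite <- (pow2_abs t); nra.
    - apply dominated_mono with (2 := H1), Rmax_l.
    - apply dominated_mono with (2 := H2), Rmax_r. }
  intros Hx Hy; destruct (Rle_dec x y); [apply W | symmetry; apply W]; lra.
Qed.

(** * Power series of integrals in a parameter *)

(** Testing with 1 and [- Ci] recovers both components. This transfers the real Taylor and mean
    value theorems to complex values, at the cost of a factor 2. *)
Lemma Cmod_le_of_Re (y : C) (m : R) :
  (forall c, Rabs (Re (c * y)%C) <= Cmod c * m) -> Cmod y <= 2 * m.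
Proof.
  intros H; assert (H1 := H (RtoC 1)); assert (H2 := H (- Ci)%C).
  rewrite Cmult_1_l, Cmod_1 in H1.
  replace (Re (- Ci * y)%C) with (Im y) in H2 by (simpl; unfold Re, Im; ring).
  replace (Cmod (- Ci)%C) with 1 in H2.
  { generalize (Cmod_le_sum y); lra. }
  unfold Cmod, Ci; simpl.
  replace (- 0 * (- 0 * 1) + - (1) * (- (1) * 1)) with 1 by ring; now rewrite sqrt_1.
Qed.

Lemma is_derive_Re_Cexp_line (c x : C) (t : R) :
  is_derive (fun t => Re (c * Cexp (RtoC t * x))%C) t (Re (c * x * Cexp (RtoC t * x))%C).
Proof.
  destruct c as [c1 c2], x as [x1 x2]; simpl.
  auto_derive; [trivial|]; unfold Rminus; ring.
Qed.

Lemma is_derive_n_Re_Cexp_line (c x : C) (n : nat) (t : R) :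
  is_derive_n (fun t => Re (c * Cexp (RtoC t * x))%C) n t
    (Re (c * Cpow x n * Cexp (RtoC t * x))%C).
Proof.
  revert t; induction n as [|n IH]; intros t.
  - simpl Cpow; now rewrite Cmult_1_r.
  - apply is_derive_ext with (fun t => Re (c * Cpow x n * Cexp (RtoC t * x))%C).
    { intros u; symmetry; apply is_derive_n_unique, IH. }
    replace (c * Cpow x (S n))%C with (c * Cpow x n * x)%C by (simpl; ring).
    apply is_derive_Re_Cexp_line.
Qed.

Notation Csum := (sum_n (G := C_AbelianGroup)).

Lemma Re_Csum (a : nat -> C) (n : nat) : Re (Csum a n) = sum_n (fun k => Re (a k)) n.
Proof.
  induction n as [|n IH]; [now rewrite !sum_O |].
  rewrite !sum_Sn, <- IH; reflexivity.
Qed.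

Lemma Im_Csum (a : nat -> C) (n : nat) : Im (Csum a n) = sum_n (fun k => Im (a k)) n.
Proof.
  induction n as [|n IH]; [now rewrite !sum_O |].
  rewrite !sum_Sn, <- IH; reflexivity.
Qed.

Lemma Csum_mult_l (c : C) (a : nat -> C) (n : nat) :
  Csum (fun k => c * a k)%C n = (c * Csum a n)%C.
Proof. apply (sum_n_mult_l (K := C_Ring)). Qed.

Definition exp_term (x : C) (k : nat) : C := (RtoC (/ INR (fact k)) * Cpow x k)%C.

(** Taylor-Lagrange on [[0, 1]] for the real function [t -> Re (c * Cexp (t * x))], whose
    derivatives are explicit. The intermediate point depends on [c], hence the family of real
    inequalities. *)
Lemma Re_Cexp_taylor (c x : C) (n : nat) :
  Rabs (Re (c * (Cexp x - Csum (exp_term x) n))%C) <=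
  Cmod c * (Cmod x ^ S n / INR (fact (S n)) * exp (Cmod x)).
Proof.
  destruct (Taylor_Lagrange (fun t => Re (c * Cexp (RtoC t * x))%C) n 0 1) as [u [Hu E]].
  - lra.
  - intros t _ k _; destruct k; [exact I|].
    eexists; exact (is_derive_n_Re_Cexp_line c x (S k) t).
  - rewrite (is_derive_n_unique _ _ _ _ (is_derive_n_Re_Cexp_line c x (S n) u)) in E.
    replace (RtoC 1 * x)%C with x in E by ring.
    assert (E2 : Re (c * (Cexp x - Csum (exp_term x) n))%C =
      (1 - 0) ^ S n / INR (fact (S n)) * Re (c * Cpow x (S n) * Cexp (RtoC u * x))%C).
    { replace (Re (c * (Cexp x - Csum (exp_term x) n))%C) with
        (Re (c * Cexp x)%C - Re (c * Csum (exp_term x) n)%C)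
        by (simpl; unfold Re, Im; ring).
      rewrite <- Csum_mult_l, Re_Csum, E.
      rewrite <- sum_n_Reals.
      apply Rplus_eq_reg_l with (sum_n (fun k => Re (c * exp_term x k)%C) n).
      match goal with |- ?A + (?B + ?D - ?A') = _ => replace B with A; [ring|] end.
      apply sum_n_ext; intros k.
      rewrite (is_derive_n_unique _ _ _ _ (is_derive_n_Re_Cexp_line c x k 0)).
      replace (RtoC 0 * x)%C with (RtoC 0) by ring; rewrite Cexp_0, Rminus_0_r, pow1.
      unfold exp_term, Rdiv; rewrite Rmult_1_l; simpl; unfold Re, Im; ring. }
    rewrite E2, Rminus_0_r, pow1.
    assert (Hf := INR_fact_lt_0 (S n)).
    unfold Rdiv at 1; rewrite Rmult_1_l, Rabs_mult, (Rabs_pos_eq (/ _))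
      by (now apply Rlt_le, Rinv_0_lt_compat).
    apply Rle_trans with (/ INR (fact (S n)) * (Cmod c * Cmod x ^ S n * exp (Cmod x))).
    + apply Rmult_le_compat_l; [now apply Rlt_le, Rinv_0_lt_compat|].
      apply Rle_trans with (1 := Cmod_ge_Re _).
      rewrite !Cmod_mult, Cmod_pow, Cmod_Cexp.
      apply Rmult_le_compat_l.
      { apply Rmult_le_pos; [apply Cmod_ge_0 | apply pow_le, Cmod_ge_0]. }
      apply exp_mono.
      apply Rle_trans with (1 := Re_le_Cmod _).
      rewrite Cmod_mult, Cmod_R, Rabs_pos_eq by lra.
      generalize (Cmod_ge_0 x); nra.
    + right; field; lra.
Qed.

Lemma Cexp_taylor (x : C) (n : nat) :
  Cmod (Cexp x - Csum (exp_term x) n)%C <=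
  2 * (Cmod x ^ S n / INR (fact (S n)) * exp (Cmod x)).
Proof.
  apply Cmod_le_of_Re; intros c; apply Re_Cexp_taylor.
Qed.

Lemma pow_fact_le_exp (x : R) (n : nat) : 0 <= x -> x ^ n / INR (fact n) <= exp x.
Proof.
  intros Hx; apply Rle_trans with (2 := exp_ge_taylor x n Hx).
  destruct n; [apply Rle_refl|].
  rewrite tech5.
  assert (0 <= sum_f_R0 (fun k => x ^ k / INR (fact k)) n).
  { apply cond_pos_sum; intros k; apply Rmult_le_pos; [now apply pow_le|].
    apply Rlt_le, Rinv_0_lt_compat, INR_fact_lt_0. }
  lra.
Qed.

(** Half of a power of 2 per term is traded against a larger exponential, by [(2 * Cmod x) ^ n / n!
    <= exp (2 * Cmod x)]. The dependence on [n] becomes a geometric factor that can be pulled out of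
    an integral. *)
Lemma Cexp_taylor_half (x : C) (n : nat) :
  Cmod (Cexp x - Csum (exp_term x) n)%C <= (/ 2) ^ n * exp (3 * Cmod x).
Proof.
  apply Rle_trans with (1 := Cexp_taylor x n).
  assert (H := pow_fact_le_exp (2 * Cmod x) (S n)).
  assert (Hx := Cmod_ge_0 x).
  assert (E : 2 * (Cmod x ^ S n / INR (fact (S n))) =
    (/ 2) ^ n * ((2 * Cmod x) ^ S n / INR (fact (S n)))).
  { rewrite Rpow_mult_distr, pow_inv; simpl (2 ^ S n).
    field; split; [apply INR_fact_neq_0 | apply pow_nonzero; lra]. }
  replace (3 * Cmod x) with (2 * Cmod x + Cmod x) by ring; rewrite exp_plus.
  rewrite <- Rmult_assoc, E, <- Rmult_assoc, Rmult_assoc.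
  rewrite (Rmult_assoc ((/ 2) ^ n) (exp (2 * Cmod x))).
  apply Rmult_le_compat_l; [apply pow_le; lra|].
  apply Rmult_le_compat_r; [apply Rlt_le, exp_pos | apply H; lra].
Qed.

Lemma is_integral_R_sum (f : nat -> R -> C) (l : nat -> C) (n : nat) :
  (forall k, is_integral_R (f k) (l k)) ->
  is_integral_R (fun t => Csum (fun k => f k t) n) (Csum l n).
Proof.
  intros H; induction n as [|n IH].
  - rewrite sum_O.
    replace (fun t => Csum (fun k => f k t) 0) with (f 0%nat); [apply H|].
    apply functional_extensionality; intros t; now rewrite sum_O.
  - rewrite sum_Sn.
    replace (fun t => Csum (fun k => f k t) (S n)) with
      (fun t => Csum (fun k => f k t) n + f (S n) t)%C.
    + exact (is_integral_R_plus _ _ _ _ IH (H (S n))).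
    + apply functional_extensionality; intros t; now rewrite sum_Sn.
Qed.

Lemma gaussian_mult (f g : R -> C) (A B beta A' B' : R) :
  gaussian f A B beta -> (forall t, continuous g t) ->
  (forall t, Cmod (g t) <= exp (A' + B' * Rabs t)) ->
  gaussian (fun t => f t * g t)%C (A + A') (B + B') beta.
Proof.
  intros [Hc Hf] Hg Hb; split; [intros t; now apply continuous_Cmult|].
  intros t; rewrite Cmod_mult.
  replace (A + A' + (B + B') * Rabs t - beta * t ^ 2) with
    ((A + B * Rabs t - beta * t ^ 2) + (A' + B' * Rabs t)) by ring.
  rewrite exp_plus; apply Rmult_le_compat; try apply Cmod_ge_0; trivial.
Qed.

Lemma continuous_exp_term (f : R -> C) (k : nat) (t : R) :
  continuous f t -> continuous (fun t => exp_term (f t) k) t.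
Proof.
  intros Hf; apply continuous_Cmult; [apply continuous_const|].
  induction k; [apply continuous_const | now apply continuous_Cmult].
Qed.

Lemma Cmod_exp_term (x : C) (k : nat) : Cmod (exp_term x k) <= exp (Cmod x).
Proof.
  unfold exp_term; rewrite Cmod_mult, Cmod_R, Rabs_pos_eq, Cmod_pow.
  - rewrite Rmult_comm; apply pow_fact_le_exp, Cmod_ge_0.
  - apply Rlt_le, Rinv_0_lt_compat, INR_fact_lt_0.
Qed.

Lemma Cpow_mult_distr (x y : C) (k : nat) : Cpow (x * y)%C k = (Cpow x k * Cpow y k)%C.
Proof. induction k as [|k IH]; simpl; [ring | rewrite IH; ring]. Qed.

Lemma Cpow_RtoC (x : R) (k : nat) : Cpow (RtoC x) k = RtoC (x ^ k).
Proof. induction k as [|k IH]; simpl; [reflexivity | now rewrite IH, RtoC_mult]. Qed.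

Lemma exp_term_scal (x : R) (y : C) (k : nat) :
  exp_term (RtoC x * y)%C k = (RtoC (x ^ k) * exp_term y k)%C.
Proof. unfold exp_term; rewrite Cpow_mult_distr, Cpow_RtoC; ring. Qed.

Lemma is_lim_seq_geom_bound (u : nat -> R) (l K : R) :
  (forall n, Rabs (u n - l) <= (/ 2) ^ n * K) -> is_lim_seq u l.
Proof.
  intros H; apply is_lim_seq_ext with (fun n => l + (u n - l)); [intros n; ring|].
  replace (Finite l) with (Rbar_plus l 0) by (simpl; now rewrite Rplus_0_r).
  apply is_lim_seq_plus'; [apply is_lim_seq_const|].
  apply is_lim_seq_abs_0.
  apply is_lim_seq_le_le with (fun _ => 0) (fun n => K * (/ 2) ^ n).
  - intros n; split; [apply Rabs_pos | rewrite Rmult_comm; apply H].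
  - apply is_lim_seq_const.
  - replace (Finite 0) with (Rbar_mult K 0) by (simpl; now rewrite Rmult_0_r).
    apply is_lim_seq_scal_l, is_lim_seq_geom; rewrite Rabs_pos_eq; lra.
Qed.

(** The variable is real and the components are separate, since the identity theorem below is
    applied to real functions on a segment. *)
Definition Cpseries (a : nat -> C) (x : R) (l : C) :=
  is_pseries (V := R_NormedModule) (fun k => Re (a k)) x (Re l) /\
  is_pseries (V := R_NormedModule) (fun k => Im (a k)) x (Im l).

Lemma Cpseries_geom (a : nat -> C) (x K : R) (l : C) :
  (forall n, Cmod (Csum (fun k => RtoC (x ^ k) * a k)%C n - l)%C <= (/ 2) ^ n * K) ->
  Cpseries a x l.
Proof.
  intros H; split; unfold is_pseries, is_series.
  - apply (is_lim_seq_geom_bound _ (Re l) K); intros n.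
    apply Rle_trans with (2 := H n).
    apply Rle_trans with (2 := Cmod_ge_Re _).
    right; f_equal; unfold Rminus.
    transitivity (Re (Csum (fun k => RtoC (x ^ k) * a k)%C n) + - Re l); [f_equal | reflexivity].
    rewrite Re_Csum; apply sum_n_ext; intros k.
    rewrite pow_n_pow; unfold scal; simpl; unfold mult, Re, Im; simpl; ring.
  - apply (is_lim_seq_geom_bound _ (Im l) K); intros n.
    apply Rle_trans with (2 := H n).
    apply Rle_trans with (2 := Cmod_ge_Im _).
    right; f_equal; unfold Rminus.
    transitivity (Im (Csum (fun k => RtoC (x ^ k) * a k)%C n) + - Im l); [f_equal | reflexivity].
    rewrite Im_Csum; apply sum_n_ext; intros k.
    rewrite pow_n_pow; unfold scal; simpl; unfold mult, Re, Im; simpl; ring.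
Qed.

(** Term-by-term integration: the coefficients are the integrals of [f * X ^ k / k!], and the Taylor
    remainder times [f] is dominated by [(/ 2) ^ n] times a fixed Gaussian. The coefficients are
    chosen before [x]. *)
Lemma integral_Cexp_series (f X : R -> C) (A B beta P Q : R) :
  0 < beta -> gaussian f A B beta -> (forall t, continuous X t) ->
  (forall t, Cmod (X t) <= P + Q * Rabs t) ->
  exists a : nat -> C, forall x : R,
    Cpseries a x (integral_R (fun t => f t * Cexp (RtoC x * X t))%C).
Proof.
  intros Hb Hf HX HXb.
  exists (fun k => integral_R (fun t => f t * exp_term (X t) k)%C); intros x.
  assert (Hk : forall k, gaussian (fun t => f t * exp_term (X t) k)%C (A + P) (B + Q) beta).
  { intros k; apply gaussian_mult; [trivial | |].
    - intros t; apply continuous_exp_term, HX.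
    - intros t; apply Rle_trans with (1 := Cmod_exp_term _ _), exp_mono, HXb. }
  set (g := fun n t => (- Csum (exp_term (RtoC x * X t)%C) n + Cexp (RtoC x * X t))%C).
  assert (HxX : forall t, continuous (fun t => RtoC x * X t)%C t).
  { intros t; apply continuous_Cmult; [apply continuous_const | apply HX]. }
  assert (HE : forall t, continuous (fun t => Cexp (RtoC x * X t))%C t).
  { intros t; apply (continuous_comp (fun t => RtoC x * X t)%C Cexp); [apply HxX|].
    apply continuous_Cexp. }
  assert (HS : forall n t, continuous (fun t => Csum (exp_term (RtoC x * X t)%C) n) t).
  { intros n t; induction n as [|n IH].
    - apply continuous_ext with (fun t => exp_term (RtoC x * X t)%C 0).
      { intros u; now rewrite sum_O. }
      apply continuous_exp_term, HxX.
    - apply continuous_ext with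
        (fun t => Csum (exp_term (RtoC x * X t)%C) n + exp_term (RtoC x * X t)%C (S n))%C.
      { intros u; now rewrite sum_Sn. }
      apply continuous_Cplus; [exact IH | apply continuous_exp_term, HxX]. }
  assert (HxXb : forall t, Cmod (RtoC x * X t)%C <= Rabs x * P + Rabs x * Q * Rabs t).
  { intros t; rewrite Cmod_mult, Cmod_R.
    replace (Rabs x * P + Rabs x * Q * Rabs t) with (Rabs x * (P + Q * Rabs t)) by ring.
    apply Rmult_le_compat_l; [apply Rabs_pos | apply HXb]. }
  assert (Hfull : gaussian (fun t => f t * Cexp (RtoC x * X t))%C
    (A + Rabs x * P) (B + Rabs x * Q) beta).
  { apply gaussian_mult; trivial; intros t; rewrite Cmod_Cexp; apply exp_mono.
    apply Rle_trans with (1 := Re_le_Cmod _), HxXb. }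
  (* The factors 3 come from [exp (3 * Cmod x)] in [Cexp_taylor_half]. *)
  set (M := gauss_const (A + 3 * (Rabs x * P)) (B + 3 * (Rabs x * Q)) beta).
  apply Cpseries_geom with (M * PI); intros n.
  assert (Hsum : is_integral_R (fun t => f t * Csum (exp_term (RtoC x * X t)%C) n)%C
    (Csum (fun k => RtoC (x ^ k) * integral_R (fun t => f t * exp_term (X t) k))%C n)).
  { replace (fun t => f t * Csum (exp_term (RtoC x * X t)%C) n)%C with
      (fun t => Csum (fun k => RtoC (x ^ k) * (f t * exp_term (X t) k))%C n).
    - apply is_integral_R_sum; intros k; apply is_integral_R_Cscal.
      eapply is_integral_R_dominated, gaussian_dominated; [exact Hb | apply Hk].
    - apply functional_extensionality; intros t.
      rewrite <- Csum_mult_l; apply sum_n_ext; intros k; rewrite exp_term_scal.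
      match goal with |- @eq _ ?u ?v => change (@eq C u v) end; ring. }
  assert (Hint := is_integral_R_dominated _ _ (gaussian_dominated _ _ _ _ Hb Hfull)).
  assert (Hdiff := is_integral_R_plus _ _ _ _ Hsum (is_integral_R_Cscal _ (- (1))%C _ Hint)).
  set (L := (Csum (fun k => RtoC (x ^ k) * integral_R (fun t => f t * exp_term (X t) k))%C n
    - integral_R (fun t => f t * Cexp (RtoC x * X t)))%C).
  replace ((/ 2) ^ n * (M * PI)) with (((/ 2) ^ n * M) * PI) by ring.
  replace L with (integral_R (fun t => f t * Csum (exp_term (RtoC x * X t)%C) n +
    - (1) * (f t * Cexp (RtoC x * X t)))%C).
  2: { rewrite (is_integral_R_unique _ _ Hdiff); unfold L; ring. }
  apply integral_R_bound; split.
  - intros t; apply continuous_Cplus; [|apply continuous_Cmult; [apply continuous_const|]].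
    + apply continuous_Cmult; [apply Hf | apply HS].
    + apply Hfull.
  - intros t.
    replace (_ + _)%C with
      (f t * (- (1) * (Cexp (RtoC x * X t) - Csum (exp_term (RtoC x * X t)%C) n)))%C by ring.
    rewrite !Cmod_mult.
    replace (Cmod (- (1))%C) with 1 by (rewrite Cmod_opp, Cmod_1; reflexivity).
    rewrite Rmult_1_l.
    apply Rle_trans with ((/ 2) ^ n * (Cmod (f t) * exp (3 * Cmod (RtoC x * X t)%C))).
    + replace ((/ 2) ^ n * (Cmod (f t) * exp (3 * Cmod (RtoC x * X t)%C))) with
        (Cmod (f t) * ((/ 2) ^ n * exp (3 * Cmod (RtoC x * X t)%C))) by ring.
      apply Rmult_le_compat_l; [apply Cmod_ge_0 | apply Cexp_taylor_half].
    + unfold Rdiv; rewrite Rmult_assoc; apply Rmult_le_compat_l; [apply pow_le; lra|].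
      apply Rle_trans with (2 := gauss_le _ _ _ t Hb).
      apply Rle_trans with (exp (A + B * Rabs t - beta * t ^ 2) *
        exp (3 * (Rabs x * P + Rabs x * Q * Rabs t))).
      * apply Rmult_le_compat; [apply Cmod_ge_0 | apply Rlt_le, exp_pos | apply Hf |].
        apply exp_mono; generalize (HxXb t); lra.
      * rewrite <- exp_plus; right; f_equal; ring.
Qed.

(** * Scaling and the geometric expansion *)

Lemma Rabs_0_le_1 : Rabs 0 <= 1.
Proof. rewrite Rabs_R0; lra. Qed.

Lemma is_Ikern (eps alpha sigma : R) (z : C) :
  Rabs eps <= 1 -> 0 < sigma -> 0 < alpha -> nz eps sigma ->
  is_integral_R (fun t => kern eps alpha z (sigma, t)) (Ikern eps alpha sigma z).
Proof.
  intros He Hs Ha Hn; destruct (kern_dominated eps alpha sigma z He Hs Ha Hn) as [M HM].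
  exact (is_integral_R_dominated _ _ HM).
Qed.

(** Since [c * w ^ 2 = (sqrt c * w) ^ 2], only the logarithm changes, by [ln (sqrt c)]. This
    contributes [c ^ (- z)]; the missing [c ^ (- 1 / 2)] is the Jacobian of the substitution. *)
Lemma kern_scale (c sigma t : R) (z : C) :
  0 < c -> 0 < sigma ->
  kern 0 c z (sigma, t) =
  (Cexp (- (2 * z) * RtoC (ln (sqrt c))) * kern 0 1 z (sqrt c * sigma, sqrt c * t)%R)%C.
Proof.
  intros Hc Hs; assert (Hk := sqrt_lt_R0 c Hc); set (k := sqrt c) in *.
  assert (E : (k * sigma, k * t)%R = (RtoC k * (sigma, t))%C)
    by (apply C_ext; simpl; ring).
  unfold kern, den; rewrite E, Clog_scal by trivial.
  rewrite (Cmult_assoc (Cexp (- (2 * z) * RtoC (ln k)))), <- Cexp_plus.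
  replace (1 - RtoC 0 * Cexp ((sigma, t) * (sigma, t)))%C with (RtoC 1) by ring.
  replace (1 - RtoC 0 * Cexp (RtoC k * (sigma, t) * (RtoC k * (sigma, t))))%C with (RtoC 1)
    by ring.
  do 2 f_equal.
  replace c with (k * k) at 1 by (apply sqrt_sqrt; lra).
  rewrite RtoC_mult; ring.
Qed.

Lemma Ikern_scale (c sigma sigma0 : R) (z : C) :
  0 < c -> 0 < sigma -> 0 < sigma0 ->
  Ikern 0 c sigma z = (Cpower (RtoC c) (- (z + RtoC (/ 2))) * Ikern 0 1 sigma0 z)%C.
Proof.
  intros Hc Hs Hs0.
  assert (Hk := sqrt_lt_R0 c Hc).
  assert (Hks : 0 < sqrt c * sigma) by now apply Rmult_lt_0_compat.
  (* The substitution sends the line [sigma] to [sqrt c * sigma]. The sum of the two abscissas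
     merely lies above both, [den 0] being free of zeros. *)
  rewrite (Ikern_shift 0 1 (sqrt c * sigma + sigma0) sigma0 (sqrt c * sigma));
    try lra; auto using nz_0, Rabs_0_le_1.
  assert (H := is_Ikern 0 1 (sqrt c * sigma) z Rabs_0_le_1 Hks Rlt_0_1 (nz_0 _)).
  apply is_integral_R_comp_scale with (1 := Hk) in H.
  apply (is_integral_R_Cscal _ (Cexp (- (2 * z) * RtoC (ln (sqrt c))))) in H.
  unfold Ikern at 1; rewrite (integral_R_ext _ _ (fun t => kern_scale c sigma t z Hc Hs)).
  rewrite (is_integral_R_unique _ _ H), Cmult_assoc; f_equal.
  rewrite <- (exp_ln (sqrt c)) at 2 by trivial.
  rewrite <- exp_Ropp, <- Cexp_RtoC, <- Cexp_plus.
  unfold Cpower; rewrite Clog_RtoC by trivial; f_equal.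
  assert (E : ln c = 2 * ln (sqrt c)).
  { rewrite <- (sqrt_sqrt c) at 1 by lra; rewrite ln_mult by trivial; ring. }
  rewrite E; apply C_ext; simpl; field.
Qed.

Lemma kern_step (eps alpha : R) (z w : C) :
  den eps w <> RtoC 0 ->
  kern eps alpha z w = (kern 0 alpha z w + RtoC eps * kern eps (alpha + 1) z w)%C.
Proof.
  intros Hd; unfold kern.
  replace (den 0 w) with (RtoC 1) by (unfold den; ring).
  rewrite RtoC_plus.
  replace (2 * z * Clog w + (RtoC alpha + 1) * (w * w))%C with
    (2 * z * Clog w + RtoC alpha * (w * w) + w * w)%C by ring.
  rewrite (Cexp_plus _ (w * w)).
  assert (E : (RtoC 1 = den eps w + RtoC eps * Cexp (w * w))%C) by (unfold den; ring).
  set (X := Cexp (2 * z * Clog w + RtoC alpha * (w * w))%C); set (Y := Cexp (w * w)) in *.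
  replace (X * / 1)%C with (X * (den eps w * / den eps w))%C.
  - transitivity (X * (den eps w + RtoC eps * Y) * / den eps w - RtoC eps * (X * Y * / den eps w)
      + RtoC eps * (X * Y * / den eps w))%C; [rewrite <- E |]; ring.
  - rewrite Cinv_r by trivial; field.
Qed.

Lemma Ikern_step (eps alpha sigma : R) (z : C) :
  Rabs eps <= 1 -> 0 < sigma -> 0 < alpha -> nz eps sigma ->
  Ikern eps alpha sigma z = (Ikern 0 alpha sigma z + RtoC eps * Ikern eps (alpha + 1) sigma z)%C.
Proof.
  intros He Hs Ha Hn.
  assert (H1 := is_Ikern 0 alpha sigma z Rabs_0_le_1 Hs Ha (nz_0 _)).
  assert (H2 : is_integral_R _ (Ikern eps (alpha + 1) sigma z))
    by (apply is_Ikern; trivial; lra).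
  apply (is_integral_R_Cscal _ (RtoC eps)) in H2.
  rewrite <- (is_integral_R_unique _ _ (is_integral_R_plus _ _ _ _ H1 H2)).
  apply integral_R_ext; intros t; apply kern_step, Hn.
Qed.

(** * Partial sums of the series and their remainder *)

Definition zeta_term (eps a : R) (s : C) (n : nat) : C :=
  (RtoC (eps ^ n) * Cpower (RtoC (INR n + a)) (- s))%C.

Lemma Ikern_partial_sum (eps a sigma sigma0 : R) (z : C) (N : nat) :
  Rabs eps <= 1 -> 0 < sigma -> 0 < sigma0 -> 0 < a -> nz eps sigma ->
  Ikern eps a sigma z =
  (Csum (zeta_term eps a (z + RtoC (/ 2))) N * Ikern 0 1 sigma0 z
   + RtoC (eps ^ S N) * Ikern eps (INR (S N) + a) sigma z)%C.
Proof.
  intros He Hs Hs0 Ha Hn.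
  assert (Hterm : forall n, (RtoC (eps ^ n) * Ikern eps (INR n + a) sigma z =
    zeta_term eps a (z + RtoC (/ 2)) n * Ikern 0 1 sigma0 z +
    RtoC (eps ^ S n) * Ikern eps (INR (S n) + a) sigma z)%C).
  { intros n; assert (Hn0 := pos_INR n).
    rewrite Ikern_step by (trivial; lra).
    rewrite (Ikern_scale _ sigma sigma0) by lra.
    rewrite S_INR; replace (INR n + 1 + a) with (INR n + a + 1) by ring.
    unfold zeta_term; simpl pow; rewrite RtoC_mult; ring. }
  induction N as [|N IH].
  - rewrite sum_O, <- Hterm; simpl; rewrite Rplus_0_l; ring.
  - rewrite sum_Sn, IH, (Hterm (S N)).
    change (plus (G := C_AbelianGroup)) with Cplus; ring.
Qed.

(** One inequality for two regimes of [u = w * w]. Up to modulus [/ 4], [Cexp u] is within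
    [Cmod u / 2] of [1 + u], so the denominator is at least [Cmod u / 2]. Beyond, [x <= / 4] forces
    [x ^ 2 - t ^ 2 <= - / 8], the exponential has modulus at most [8 / 9], and the denominator is at
    least [/ 9]; hence the 9. *)
Lemma den_small (eps x t : R) :
  eps = 1 \/ eps = -1 -> 0 < x <= / 4 ->
  x ^ 2 + t ^ 2 <= 9 * (1 + (x ^ 2 + t ^ 2)) * Cmod (den eps (x, t)).
Proof.
  intros He Hx.
  assert (Hx2 : 0 < x ^ 2 <= / 16) by (split; nra).
  assert (Ht2 := pow2_ge_0 t).
  set (u := ((x, t) * (x, t))%C).
  assert (Hu : Cmod u = x ^ 2 + t ^ 2)
    by (unfold u; rewrite Cmod_mult, Cmod_sqr; reflexivity).
  assert (Hd := Cmod_ge_0 (den eps (x, t))).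
  assert (HE : den eps (x, t) = (1 - RtoC eps * Cexp u)%C) by reflexivity.
  assert (Hm0 : 0 < x ^ 2 + t ^ 2) by lra.
  set (m := x ^ 2 + t ^ 2) in *.
  destruct (Rle_dec m (/ 4)) as [Hm | Hm].
  - assert (T := Cexp_taylor u 1).
    rewrite sum_Sn, sum_O in T; unfold exp_term in T; simpl in T.
    replace (plus _ _) with (1 + u)%C in T.
    2: { change (1 + u = RtoC (/ 1) * 1 + RtoC (/ 1) * (u * 1))%C; rewrite Rinv_1; ring. }
    rewrite Hu in T.
    assert (exp m <= 2).
    { apply Rle_trans with (exp (/ 4)); [now apply exp_mono|].
      generalize (exp_ineq1_le (- / 4)); rewrite exp_Ropp; intros K.
      apply Rmult_le_reg_l with (/ exp (/ 4)); [apply Rinv_0_lt_compat, exp_pos|].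
      rewrite Rinv_l by (apply Rgt_not_eq, exp_pos); lra. }
    assert (B : Cmod (Cexp u - (1 + u))%C <= m / 2).
    { apply Rle_trans with (1 := T).
      replace (2 * (m * (m * 1) / (1 + 1) * exp m)) with (m * (m * exp m)) by field.
      unfold Rdiv; apply Rmult_le_compat_l; [lra|]; nra. }
    assert (m / 2 <= Cmod (den eps (x, t))); [|nra].
    destruct He as [-> | ->].
    + assert (K := Cmod_triangle (den 1 (x, t)) (Cexp u - (1 + u))).
      replace (den 1 (x, t) + _)%C with (- u)%C in K by (rewrite HE; ring).
      rewrite Cmod_opp, Hu in K; lra.
    + assert (K := Cmod_triangle (den (-1) (x, t)) (- ((Cexp u - (1 + u)) + u))).
      replace (den (-1) (x, t) + _)%C with (RtoC 2) in K.
      2: { rewrite HE; replace (RtoC (-1)) with (- (1))%C by (apply C_ext; simpl; ring).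
           apply C_ext; simpl; ring. }
      assert (K' := Cmod_triangle (Cexp u - (1 + u)) u).
      rewrite Cmod_opp, Cmod_R, Rabs_pos_eq in K by lra; lra.
  - assert (K := Cmod_triangle (den eps (x, t)) (RtoC eps * Cexp u)).
    replace (den eps (x, t) + _)%C with (RtoC 1) in K by (rewrite HE; ring).
    rewrite Cmod_1, Cmod_mult, Cmod_R, Cmod_Cexp in K.
    replace (Re u) with (x ^ 2 - t ^ 2) in K by (symmetry; apply Re_sqr).
    replace (Rabs eps) with 1 in K
      by (destruct He as [-> | ->]; unfold Rabs; destruct Rcase_abs; lra).
    assert (exp (x ^ 2 - t ^ 2) <= 8 / 9).
    { apply Rle_trans with (exp (- / 8)); [apply exp_mono; unfold m in *; lra|].
      rewrite exp_Ropp; replace (8 / 9) with (/ (1 + / 8)) by field.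
      apply Rinv_le_contravar; [lra | apply exp_ineq1_le]. }
    nra.
Qed.

(** With [m] the squared modulus of [w], the power supplies [m * m], up to factors growing
    exponentially in [Rabs t]. One [m] pays for the denominator, the other, against half of the
    Gaussian, gives [3 / alpha]. The constant is [108 = 9 * 3 * 4]. *)
Lemma kern_small_sigma (eps alpha t : R) (z : C) :
  eps = 1 \/ eps = -1 -> nz eps (sqrt (/ alpha)) -> 16 <= alpha -> 2 <= Re z ->
  Cmod (kern eps alpha z (sqrt (/ alpha), t)) <=
  108 / alpha * exp ((2 * Re z - 4) + 4 * Rabs (Im z) + 1 + (2 * Re z - 3) * Rabs t
    - / 2 * t ^ 2).
Proof.
  intros He Hn Ha Hz.
  assert (Hia : 0 < / alpha <= / 16)
    by (split; [apply Rinv_0_lt_compat | apply Rinv_le_contravar]; lra).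
  set (x := sqrt (/ alpha)) in *.
  assert (Hx0 : 0 < x) by (apply sqrt_lt_R0; lra).
  assert (Hxx : x ^ 2 = / alpha) by (simpl; rewrite Rmult_1_r; apply sqrt_sqrt; lra).
  assert (Hx : x <= / 4) by nra.
  assert (Hd : 0 < Cmod (den eps (x, t))) by apply Cmod_gt_0, Hn.
  assert (Hden := den_small eps x t He (conj Hx0 Hx)).
  set (m := x ^ 2 + t ^ 2) in *.
  assert (Ht2 := pow2_ge_0 t).
  assert (Hm0 : 0 < m) by (unfold m; lra).
  set (w := (x, t) : C).
  assert (Hw : 0 < Cmod w) by apply (Re_pos_Cmod w Hx0).
  assert (Hwm : Cmod w * Cmod w = m) by apply Cmod_sqr.
  unfold kern; rewrite Cmod_mult, Cmod_inv, Cmod_Cexp by (apply Cmod_gt_0, Hd).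
  (* Only [4 * ln (Cmod w)], which is [2 * ln m], is kept exactly; the remaining multiple
     [2 * Re z - 4] of the logarithm is nonnegative, so an upper bound of the logarithm is
     enough. *)
  assert (E1 : Re (2 * z * Clog w + RtoC alpha * (w * w))%C <=
    (2 * ln m) + ((2 * Re z - 4) * (1 + Rabs t) + 4 * Rabs (Im z) + 1 - alpha * t ^ 2)).
  { assert (EL : Clog w = (ln (Cmod w), atan (t / x)))
      by (unfold Clog; now rewrite Carg_atan).
    rewrite EL.
    replace (Re (2 * z * (ln (Cmod w), atan (t / x)) + RtoC alpha * (w * w))%C) with
      (4 * ln (Cmod w) + (2 * Re z - 4) * ln (Cmod w) - 2 * Im z * atan (t / x)
        + alpha * (x ^ 2 - t ^ 2)) by (simpl; unfold Re, Im; ring).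
    rewrite Hxx.
    assert (ln m = 2 * ln (Cmod w)) by (rewrite <- Hwm, ln_mult by trivial; ring).
    assert (ln (Cmod w) <= 1 + Rabs t).
    { apply Rle_trans with (1 := ln_le_self _ Hw).
      apply Rle_trans with (1 := Cmod_le_sum w); simpl.
      rewrite (Rabs_pos_eq x) by lra; lra. }
    assert ((2 * Re z - 4) * ln (Cmod w) <= (2 * Re z - 4) * (1 + Rabs t))
      by (apply Rmult_le_compat_l; lra).
    assert (- 2 * Im z * atan (t / x) <= 4 * Rabs (Im z)).
    { apply Rle_trans with (1 := Rle_abs _); rewrite !Rabs_mult.
      replace (Rabs (- 2)) with 2 by (unfold Rabs; destruct Rcase_abs; lra).
      assert (Rabs (atan (t / x)) <= 2).
      { apply Rabs_le; generalize (atan_bound (t / x)) PI_4; lra. }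
      generalize (Rabs_pos (Im z)) (Rabs_pos (atan (t / x))); nra. }
    replace (alpha * (/ alpha - t ^ 2)) with (1 - alpha * t ^ 2) by (field; lra).
    lra. }
  apply exp_mono in E1; rewrite exp_plus in E1.
  replace (exp (2 * ln m)) with (m * m) in E1
    by (rewrite <- (exp_ln m) at 1 2 by trivial; rewrite <- exp_plus; f_equal; ring).
  set (Q := (2 * Re z - 4) * (1 + Rabs t) + 4 * Rabs (Im z) + 1) in *.
  apply Rle_trans with (m * m * exp (Q - alpha * t ^ 2) * / Cmod (den eps w)).
  { apply Rmult_le_compat_r; [now apply Rlt_le, Rinv_0_lt_compat | exact E1]. }
  apply Rle_trans with (m * (9 * (1 + m)) * exp (Q - alpha * t ^ 2)).
  { replace (m * m * exp (Q - alpha * t ^ 2) * / Cmod (den eps w)) with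
      (m * (m * / Cmod (den eps w)) * exp (Q - alpha * t ^ 2)) by ring.
    apply Rmult_le_compat_r; [apply Rlt_le, exp_pos|].
    apply Rmult_le_compat_l; [lra|].
    apply Rmult_le_reg_r with (Cmod (den eps w)); [exact Hd|].
    rewrite Rmult_assoc, Rinv_l, Rmult_1_r; [exact Hden | now apply Rgt_not_eq]. }
  (* The Gaussian is split in two halves. With [y = alpha / 2 * t ^ 2], [m] equals
     [(1 + 2 * y) / alpha], and the first half absorbs [1 + 2 * y <= 3 * exp y]; the second is
     weakened to [exp (- t ^ 2 / 2)], uniformly in [alpha]. *)
  assert (E2 : m * exp (- alpha * t ^ 2) <= 3 / alpha * exp (- / 2 * t ^ 2)).
  { apply Rle_trans with (3 / alpha * exp (- (alpha / 2 * t ^ 2))).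
    - replace (- alpha * t ^ 2) with (- (alpha / 2 * t ^ 2) + - (alpha / 2 * t ^ 2)) by field.
      rewrite exp_plus, <- Rmult_assoc.
      apply Rmult_le_compat_r; [apply Rlt_le, exp_pos|].
      set (y := alpha / 2 * t ^ 2).
      assert (Hy : 0 <= y) by (apply Rmult_le_pos; lra).
      assert (Em : m = / alpha + 2 / alpha * y)
        by (unfold m, y; rewrite Hxx; field; lra).
      rewrite Em, exp_Ropp.
      apply Rmult_le_reg_r with (exp y); [apply exp_pos|].
      rewrite Rmult_assoc, Rinv_l, Rmult_1_r by (apply Rgt_not_eq, exp_pos).
      replace (3 / alpha) with (/ alpha * 3) by (unfold Rdiv; ring).
      replace (/ alpha + 2 / alpha * y) with (/ alpha * (1 + 2 * y)) by (unfold Rdiv; ring).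
      rewrite Rmult_assoc; apply Rmult_le_compat_l; [lra|].
      generalize (exp_ineq1_le y); lra.
    - apply Rmult_le_compat_l; [unfold Rdiv; lra|]; apply exp_mono; nra. }
  assert (E3 : 1 + m <= 4 * exp (Rabs t)).
  { generalize (exp_ge_quad (Rabs t) (Rabs_pos t)); rewrite pow2_abs; unfold m; lra. }
  replace (exp (Q - alpha * t ^ 2)) with (exp Q * exp (- alpha * t ^ 2))
    by (rewrite <- exp_plus; f_equal; ring).
  replace (m * (9 * (1 + m)) * (exp Q * exp (- alpha * t ^ 2))) with
    (9 * exp Q * ((m * exp (- alpha * t ^ 2)) * (1 + m))) by ring.
  apply Rle_trans with
    (9 * exp Q * ((3 / alpha * exp (- / 2 * t ^ 2)) * (4 * exp (Rabs t)))).
  - apply Rmult_le_compat_l; [generalize (exp_pos Q); lra|].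
    apply Rmult_le_compat; trivial; [|lra].
    apply Rmult_le_pos; [lra | apply Rlt_le, exp_pos].
  - right.
    replace (2 * Re z - 4 + 4 * Rabs (Im z) + 1 + (2 * Re z - 3) * Rabs t - / 2 * t ^ 2) with
      (Q + (- / 2 * t ^ 2) + Rabs t) by (unfold Q; ring).
    rewrite !exp_plus; field; lra.
Qed.

Lemma Ikern_small_sigma (eps : R) (z : C) :
  eps = 1 \/ eps = -1 -> 2 <= Re z ->
  exists K, forall alpha, 16 <= alpha -> nz eps (sqrt (/ alpha)) ->
    Cmod (Ikern eps alpha (sqrt (/ alpha)) z) <= K / alpha.
Proof.
  intros He Hz.
  set (A := (2 * Re z - 4) + 4 * Rabs (Im z) + 1).
  exists (108 * gauss_const A (2 * Re z - 3) (/ 2) * PI); intros alpha Ha Hn.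
  replace (108 * gauss_const A (2 * Re z - 3) (/ 2) * PI / alpha) with
    (108 / alpha * gauss_const A (2 * Re z - 3) (/ 2) * PI) by (field; lra).
  assert (Hs : 0 < sqrt (/ alpha)) by (apply sqrt_lt_R0, Rinv_0_lt_compat; lra).
  apply integral_R_bound; split.
  - intros t; now apply kern_continuous.
  - intros t; apply Rle_trans with (1 := kern_small_sigma eps alpha t z He Hn Ha Hz).
    unfold Rdiv at 2; rewrite Rmult_assoc; apply Rmult_le_compat_l.
    + apply Rlt_le, Rdiv_lt_0_compat; lra.
    + apply gauss_le; lra.
Qed.

Lemma zeta_integral_large (eps a q sigma sigma0 : R) (z l : C) :
  eps = 1 \/ eps = -1 -> (forall s, 0 < s < q -> nz eps s) -> / 4 < q ->
  0 < sigma < q -> 0 < sigma0 -> 0 < a -> 2 <= Re z ->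
  is_series (K := C_AbsRing) (V := C_NormedModule) (zeta_term eps a (z + RtoC (/ 2))) l ->
  (l * Ikern 0 1 sigma0 z)%C = Ikern eps a sigma z.
Proof.
  intros He Hn Hq Hs Hs0 Ha Hz Hl.
  assert (He1 : Rabs eps = 1)
    by (destruct He as [-> | ->]; unfold Rabs; destruct Rcase_abs; lra).
  destruct (Ikern_small_sigma eps z He Hz) as [K HK].
  set (G0 := Ikern 0 1 sigma0 z); set (I0 := Ikern eps a sigma z).
  set (S := Csum (zeta_term eps a (z + RtoC (/ 2)))).
  set (f := fun N => (S N * G0 + - I0)%C).
  assert (L1 : filterlim f eventually (locally (l * G0 + - I0)%C)).
  { apply (filterlim_comp _ _ _ S (fun u => u * G0 + - I0)%C eventually (locally l)).
    - exact Hl.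
    - exact (continuous_Cplus C_UniformSpace (fun u => u * G0)%C (fun _ => - I0)%C l
        (continuous_Cmult _ _ _ _ (continuous_id _) (continuous_const _ _))
        (continuous_const _ _)). }
  (* [K] bounds a modulus at the smallest admissible [alpha = 16], where the line has abscissa
     [/ 4]. *)
  assert (HK0 : 0 <= K).
  { assert (H16 : nz eps (sqrt (/ 16))).
    { apply Hn; replace (/ 16) with (/ 4 * / 4) by field; rewrite sqrt_square; lra. }
    specialize (HK 16 (Rle_refl _) H16).
    generalize (Cmod_ge_0 (Ikern eps 16 (sqrt (/ 16)) z)); lra. }
  (* From [N = 15] on, [al = N + 1 + a] is at least 16, so the line [sqrt (/ al)] lies within
     [/ 4 < q] and can be reached without meeting a zero of [den]. *)
  assert (B : forall N, (15 <= N)%nat -> Cmod (f N) <= K * / (INR N + 1)).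
  { intros N HN.
    assert (HN' : 15 <= INR N) by (apply (le_INR 15) in HN; simpl in HN; lra).
    unfold f, I0; rewrite (Ikern_partial_sum eps a sigma sigma0 z N); try lra; [|now apply Hn].
    fold G0 S; rewrite S_INR; set (al := INR N + 1 + a).
    assert (Hal : 16 <= al) by (unfold al; lra).
    assert (Hsq : 0 < sqrt (/ al) <= / 4).
    { split; [apply sqrt_lt_R0, Rinv_0_lt_compat; lra|].
      rewrite <- (sqrt_square (/ 4)) by lra; apply sqrt_le_1_alt.
      replace (/ 4 * / 4) with (/ 16) by field; apply Rinv_le_contravar; lra. }
    rewrite (Ikern_shift eps al q sigma (sqrt (/ al))); trivial; try lra.
    replace (S N * G0 + _)%C with
      (- (RtoC (eps ^ (N + 1)) * Ikern eps al (sqrt (/ al)) z))%C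
      by (rewrite Nat.add_1_r; ring).
    rewrite Cmod_opp, Cmod_mult, Cmod_R, <- RPow_abs, He1, pow1, Rmult_1_l.
    apply Rle_trans with (K / al); [apply HK; trivial; apply Hn; lra|].
    apply Rmult_le_compat_l; [trivial|]; apply Rinv_le_contravar; unfold al; lra. }
  assert (L2 : filterlim f eventually (locally (RtoC 0))).
  { apply (filterlim_locally (U := C_R_NormedModule)); intros e.
    assert (LK : is_lim_seq (fun N => K * / (INR N + 1)) 0).
    { replace (Finite 0) with (Rbar_mult K 0) by (simpl; now rewrite Rmult_0_r).
      apply is_lim_seq_scal_l.
      apply is_lim_seq_ext with (fun N => / INR (Datatypes.S N)).
      { intros n; now rewrite S_INR. }
      apply (is_lim_seq_incr_1 (fun n => / INR n)).
      replace (Finite 0) with (Rbar_inv p_infty) by reflexivity.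
      apply is_lim_seq_inv; [apply is_lim_seq_INR | discriminate]. }
    apply is_lim_seq_spec in LK; destruct (LK e) as [N0 HN0].
    exists (Nat.max 15 N0); intros N HN.
    apply (norm_compat1 (V := C_R_NormedModule)); rewrite norm_C.
    change (Cmod (f N - RtoC 0)%C < e).
    replace (f N - RtoC 0)%C with (f N) by ring.
    apply Rle_lt_trans with (1 := B N ltac:(lia)).
    specialize (HN0 N ltac:(lia)); apply Rle_lt_trans with (2 := HN0).
    rewrite Rminus_0_r; apply Rle_abs. }
  assert (E := filterlim_locally_unique (V := C_R_NormedModule) _ _ _ L1 L2).
  replace (l * G0)%C with ((l * G0 + - I0) + I0)%C by ring.
  rewrite E; ring.
Qed.

(** * Nonvanishing of G *)

Lemma kern_0_shift (z c w : C) :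
  0 < Re w -> kern 0 1 (z + RtoC (/ 2)) w = (w * kern 0 1 z w)%C.
Proof.
  intros Hw; unfold kern, den.
  set (D := (/ (1 - RtoC 0 * Cexp (w * w)))%C).
  transitivity (Cexp (Clog w) * Cexp (2 * z * Clog w + RtoC 1 * (w * w)) * D)%C.
  - rewrite <- Cexp_plus; do 2 f_equal.
    rewrite Cmult_plus_distr_l.
    replace (2 * RtoC (/ 2))%C with (RtoC 1) by (rewrite <- RtoC_mult; f_equal; field).
    ring.
  - rewrite Cexp_Clog by trivial; ring.
Qed.

(** The [t]-derivative of [w ^ (2 z + 1) * e ^ (w ^ 2)] is [Ci * ((2 z + 1) * w ^ (2 z) + 2 * w ^ (2
    z + 2)) * e ^ (w ^ 2)], and its integral vanishes. *)
Lemma Ikern_0_succ (sigma : R) (z : C) :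
  0 < sigma -> Ikern 0 1 sigma (z + 1)%C = (- (z + RtoC (/ 2)) * Ikern 0 1 sigma z)%C.
Proof.
  intros Hs.
  assert (Hk : forall z w, 0 < Re w -> kern 0 1 (z + RtoC (/ 2)) w = (w * kern 0 1 z w)%C)
    by (intros; now apply kern_0_shift).
  set (g := fun t => kern 0 1 (z + RtoC (/ 2)) (sigma, t)).
  set (g' := fun t =>
    (Ci * ((2 * z + 1) * kern 0 1 z (sigma, t)) + 2 * Ci * kern 0 1 (z + 1) (sigma, t))%C).
  assert (Hg' : forall t, Cderiv g t (g' t)).
  { intros t.
    assert (Hw : 0 < Re (sigma, t)) by exact Hs.
    assert (Hw0 := Re_pos_neq_0 _ Hw).
    assert (H : hol (fun w => Cexp (2 * (z + RtoC (/ 2)) * Clog w + RtoC 1 * (w * w)))%C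
      (fun w => (2 * (z + RtoC (/ 2)) * / w + RtoC 1 * (1 * w + w * 1)) *
        Cexp (2 * (z + RtoC (/ 2)) * Clog w + RtoC 1 * (w * w)))%C (sigma, t)).
    { apply hol_Cexp, hol_plus; apply hol_Cscal; [now apply hol_Clog|].
      apply hol_mult; apply hol_id. }
    generalize (H _ t _ eq_refl (Cderiv_vline sigma t)).
    assert (E : forall z w, kern 0 1 z w = Cexp (2 * z * Clog w + RtoC 1 * (w * w))%C).
    { intros z' w'; unfold kern, den.
      replace (/ (1 - RtoC 0 * Cexp (w' * w')))%C with (RtoC 1); [ring|].
      replace (1 - RtoC 0 * Cexp (w' * w'))%C with (RtoC 1) by ring.
      field. }
    apply Cderiv_ext.
    - intros u; unfold g; now rewrite E.
    - rewrite <- E; unfold g'.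
      replace (z + 1)%C with ((z + RtoC (/ 2)) + RtoC (/ 2))%C.
      + rewrite !Hk by trivial.
        set (k := kern 0 1 z (sigma, t)); set (w := (sigma, t) : C) in *.
        replace (2 * (z + RtoC (/ 2)))%C with (2 * z + 1)%C.
        * field; exact Hw0.
        * rewrite Cmult_plus_distr_l, <- RtoC_mult; do 2 f_equal; field.
      + rewrite <- Cplus_assoc, <- RtoC_plus; do 2 f_equal; field. }
  assert (Hi : is_integral_R g'
    (Ci * ((2 * z + 1) * Ikern 0 1 sigma z) + 2 * Ci * Ikern 0 1 sigma (z + 1))%C).
  { assert (I0 := is_Ikern 0 1 sigma z Rabs_0_le_1 Hs Rlt_0_1 (nz_0 _)).
    assert (I1 := is_Ikern 0 1 sigma (z + 1)%C Rabs_0_le_1 Hs Rlt_0_1 (nz_0 _)).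
    exact (is_integral_R_plus _ _ _ _
      (is_integral_R_Cscal _ Ci _ (is_integral_R_Cscal _ (2 * z + 1)%C _ I0))
      (is_integral_R_Cscal _ (2 * Ci)%C _ I1)). }
  assert (Hc : forall t, continuous g' t).
  { intros t; apply continuous_Cplus.
    - exact (continuous_Cmult _ _ _ _ (continuous_const _ _)
        (continuous_Cmult _ _ _ _ (continuous_const _ _)
          (kern_continuous 0 1 sigma z t Hs (nz_0 _)))).
    - exact (continuous_Cmult _ _ _ _ (continuous_const _ _)
          (kern_continuous 0 1 sigma (z + 1) t Hs (nz_0 _))). }
  destruct (kern_dominated 0 1 sigma (z + RtoC (/ 2)) Rabs_0_le_1 Hs Rlt_0_1 (nz_0 _)) as [M HM].
  assert (H0 := is_integral_R_derive g g' M Hg' Hc (proj2 HM)).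
  assert (E : (Ci * ((2 * z + 1) * Ikern 0 1 sigma z) + 2 * Ci * Ikern 0 1 sigma (z + 1))%C
    = RtoC 0).
  { rewrite <- (is_integral_R_unique _ _ Hi); now apply is_integral_R_unique. }
  set (I0 := Ikern 0 1 sigma z) in *; set (I1 := Ikern 0 1 sigma (z + 1)) in *.
  replace I1 with (- (z + RtoC (/ 2)) * I0 + - (Ci * RtoC (/ 2)) *
    (Ci * ((2 * z + 1) * I0) + 2 * Ci * I1))%C.
  - rewrite E; ring.
  - destruct z, I0, I1; apply C_ext; simpl; field.
Qed.

(** Going from [z - n] to [z - (n + 1)] divides by a factor that vanishes only if [z + / 2 = n + 1],
    which is excluded. *)
Lemma Ikern_0_zero_down (sigma : R) (z : C) (n : nat) :
  0 < sigma ->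
  (forall n : nat, (1 <= n)%nat -> (z + RtoC (/ 2))%C <> RtoC (INR n)) ->
  Ikern 0 1 sigma z = RtoC 0 -> Ikern 0 1 sigma (z - RtoC (INR n))%C = RtoC 0.
Proof.
  intros Hs Hz H0; induction n as [|n IH].
  - simpl; now replace (z - RtoC 0)%C with z by ring.
  - assert (E := Ikern_0_succ sigma (z - RtoC (INR (S n))) Hs).
    replace (z - RtoC (INR (S n)) + 1)%C with (z - RtoC (INR n))%C in E
      by (rewrite S_INR, RtoC_plus; ring).
    rewrite IH in E.
    set (J := Ikern 0 1 sigma (z - RtoC (INR (S n)))) in *.
    destruct (Ceq_dec J (RtoC 0)) as [|HJ]; [trivial|].
    exfalso; apply (Cmult_neq_0 (- (z - RtoC (INR (S n)) + RtoC (/ 2)))%C J); trivial; [|easy].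
    intros E'; apply (Hz (S n)); [lia|].
    replace (z + RtoC (/ 2))%C with
      (- - (z - RtoC (INR (S n)) + RtoC (/ 2)) + RtoC (INR (S n)))%C by ring.
    rewrite E'; ring.
Qed.

(** Mean value theorem along the segment from [b] to [a], on which the real part stays below [m]. *)
Lemma Cmod_Cexp_sub_le (a b : C) (m : R) :
  Re a <= m -> Re b <= m -> Cmod (Cexp a - Cexp b)%C <= 2 * (Cmod (a - b)%C * exp m).
Proof.
  intros Ha Hb.
  apply Cmod_le_of_Re; intros c.
  destruct (MVT_gen (fun t => Re (c * Cexp b * Cexp (RtoC t * (a - b)))%C) 0 1
    (fun t => Re (c * Cexp b * (a - b) * Cexp (RtoC t * (a - b)))%C)) as [u [Hu E]].
  - intros x _; apply is_derive_Re_Cexp_line.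
  - intros x _; apply continuity_pt_filterlim.
    eapply continuous_real, is_derive_Re_Cexp_line.
  - rewrite Rmin_left, Rmax_right in Hu by lra.
    replace (RtoC 1 * (a - b))%C with (a - b)%C in E by ring.
    replace (RtoC 0 * (a - b))%C with (RtoC 0) in E by ring.
    rewrite Cexp_0, Rminus_0_r, Rmult_1_r in E.
    assert (E1 : (c * Cexp b * Cexp (a - b) = c * Cexp a)%C).
    { rewrite <- Cmult_assoc, <- Cexp_plus; do 2 f_equal; ring. }
    rewrite E1 in E.
    replace (Re (c * (Cexp a - Cexp b))%C) with
      (Re (c * Cexp a)%C - Re (c * Cexp b * 1)%C) by (simpl; unfold Re, Im; ring).
    rewrite E; apply Rle_trans with (1 := Cmod_ge_Re _).
    replace (c * Cexp b * (a - b) * Cexp (RtoC u * (a - b)))%C with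
      (c * ((a - b) * (Cexp b * Cexp (RtoC u * (a - b)))))%C by ring.
    rewrite <- Cexp_plus, !Cmod_mult, Cmod_Cexp.
    apply Rmult_le_compat_l; [apply Cmod_ge_0|].
    apply Rmult_le_compat_l; [apply Cmod_ge_0|].
    apply exp_mono.
    replace (Re (b + RtoC u * (a - b))%C) with (Re b + u * (Re a - Re b))
      by (simpl; unfold Re, Im; ring).
    nra.
Qed.

(** * Expansion of the logarithm at 1 and the saddle-point estimate *)

Lemma ln_1_plus_bounds (u : R) : 0 <= u -> u - u ^ 2 <= ln (1 + u) <= u.
Proof.
  intros Hu; split.
  - assert (H := exp_ineq1_le (ln (/ (1 + u)))).
    rewrite exp_ln in H by (apply Rinv_0_lt_compat; lra).
    rewrite ln_Rinv in H by lra.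
    assert (E : 1 - / (1 + u) = u - u ^ 2 * / (1 + u)) by (field; lra).
    assert (u ^ 2 * / (1 + u) <= u ^ 2 * 1).
    { apply Rmult_le_compat_l; [apply pow2_ge_0|].
      rewrite <- Rinv_1; apply Rinv_le_contravar; lra. }
    lra.
  - assert (H := exp_ineq1_le (ln (1 + u))); rewrite exp_ln in H; lra.
Qed.

Lemma atan_mean_value (y : R) :
  exists c, Rabs c <= Rabs y /\ atan y = / (1 + c ^ 2) * y.
Proof.
  destruct (MVT_gen atan 0 y (fun x => / (1 + x ^ 2))) as [c [Hc E]].
  - intros x _; apply is_derive_Reals, derivable_pt_lim_atan.
  - intros x _; apply continuity_pt_filterlim, continuous_atan.
  - exists c; split.
    + revert Hc; unfold Rmin, Rmax, Rabs; repeat destruct Rle_dec; repeat destruct Rcase_abs; lra.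
    + rewrite atan_0 in E; lra.
Qed.

Lemma inv_1_plus_sqr_bounds (c : R) : 0 < / (1 + c ^ 2) <= 1.
Proof.
  generalize (one_plus_sqr_pos c) (pow2_ge_0 c); intros H1 H2.
  split; [now apply Rinv_0_lt_compat|].
  rewrite <- Rinv_1; apply Rinv_le_contravar; lra.
Qed.

Lemma Rabs_atan_le (y : R) : Rabs (atan y) <= Rabs y.
Proof.
  destruct (atan_mean_value y) as [c [_ ->]].
  assert (H := inv_1_plus_sqr_bounds c).
  rewrite Rabs_mult, (Rabs_pos_eq (/ _)) by lra.
  generalize (Rabs_pos y); nra.
Qed.

Lemma atan_sub_id_le (y : R) : Rabs (atan y - y) <= Rabs y ^ 3.
Proof.
  destruct (atan_mean_value y) as [c [Hc ->]].
  assert (H := inv_1_plus_sqr_bounds c).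
  assert (Hp := one_plus_sqr_pos c); assert (Hc0 := pow2_ge_0 c).
  assert (Hc2 : c ^ 2 <= Rabs y ^ 2).
  { rewrite <- (pow2_abs c); apply pow_incr; split; [apply Rabs_pos | exact Hc]. }
  replace (/ (1 + c ^ 2) * y - y) with (- (c ^ 2 * / (1 + c ^ 2)) * y) by (field; lra).
  rewrite Rabs_mult, Rabs_Ropp, (Rabs_pos_eq (_ * _)) by nra.
  replace (Rabs y ^ 3) with (Rabs y ^ 2 * Rabs y) by ring.
  apply Rmult_le_compat_r; [apply Rabs_pos | nra].
Qed.

Lemma Clog_1_y (y : R) : Clog (1, y) = (/ 2 * ln (1 + y ^ 2), atan y).
Proof.
  rewrite Clog_atan by (simpl; lra); simpl; f_equal.
  - replace (1 * (1 * 1)) with 1 by ring.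
    assert (H : 0 < 1 + y * (y * 1)) by (generalize (one_plus_sqr_pos y); simpl; lra).
    assert (Hq := sqrt_lt_R0 _ H).
    rewrite <- (sqrt_sqrt (1 + y * (y * 1))) at 2 by lra.
    rewrite ln_mult by trivial; field.
  - f_equal; field.
Qed.

Lemma Clog_1_y_le (y : R) : Cmod (Clog (1, y)) <= 2 * Rabs y.
Proof.
  rewrite Clog_1_y; apply Rle_trans with (1 := Cmod_le_sum _); simpl.
  assert (H1 : 0 <= ln (1 + y * (y * 1)) <= 2 * Rabs y).
  { assert (Hy : y * (y * 1) = Rabs y * Rabs y) by (rewrite <- Rabs_mult, Rabs_pos_eq; nra).
    assert (Hp := Rabs_pos y); split.
    - rewrite <- ln_1; apply ln_le; nra.
    - apply Rle_trans with (ln ((1 + Rabs y) * (1 + Rabs y))).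
      + apply ln_le; nra.
      + rewrite ln_mult by lra.
        generalize (ln_1_plus_bounds (Rabs y) Hp); lra. }
  assert (H2 := Rabs_atan_le y).
  rewrite (Rabs_pos_eq (_ * _)) by lra; lra.
Qed.

(** The order of the error is what counts: with [y = t / sqrt n] and the factor [2 * n] in front,
    cubic and quartic terms become [O(1 / sqrt n)]. *)
Lemma Clog_1_y_expand (y : R) :
  Cmod (Clog (1%R, y) - ((y ^ 2 / 2)%R, y))%C <= Rabs y ^ 4 + Rabs y ^ 3.
Proof.
  rewrite Clog_1_y; apply Rle_trans with (1 := Cmod_le_sum _).
  apply Rplus_le_compat.
  - unfold Re, Cminus, Cplus, Copp, fst, snd.
    assert (H := ln_1_plus_bounds (y ^ 2) (pow2_ge_0 y)).
    replace (Rabs y ^ 4) with ((y ^ 2) ^ 2) by (rewrite <- (pow2_abs y); ring).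
    apply Rabs_le; generalize (pow2_ge_0 (y ^ 2)); lra.
  - exact (atan_sub_id_le y).
Qed.

(* Exponent of the integrand of G(z-n) on the line sigma = sqrt n, up to a
   constant; it tends to -2t^2, see [saddle_bound]. *)
Definition saddle (n : R) (z : C) (t : R) : C :=
  (2 * (z - RtoC n) * Clog (1%R, (t / sqrt n)%R) + ((- t ^ 2)%R, (2 * sqrt n * t)%R))%C.

Lemma kern_saddle (n t : R) (z : C) :
  0 < n ->
  kern 0 1 (z - RtoC n) (sqrt n, t) =
  (Cexp (2 * (z - RtoC n) * RtoC (ln (sqrt n)) + RtoC n) * Cexp (saddle n z t))%C.
Proof.
  intros Hn; assert (Hk := sqrt_lt_R0 n Hn); assert (Hkk := sqrt_sqrt n (Rlt_le _ _ Hn)).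
  unfold kern; replace (den 0 (sqrt n, t)) with (RtoC 1) by (unfold den; ring).
  replace (/ 1)%C with (RtoC 1) by field; rewrite Cmult_1_r, <- Cexp_plus; f_equal.
  assert (E : (sqrt n, t) = (RtoC (sqrt n) * (1%R, (t / sqrt n)%R))%C)
    by (apply C_ext; simpl; field; lra).
  rewrite E at 1; rewrite Clog_scal by (simpl; lra).
  unfold saddle.
  replace (RtoC 1 * ((sqrt n, t) * (sqrt n, t)))%C with
    (RtoC n + ((- t ^ 2)%R, (2 * sqrt n * t)%R))%C by (apply C_ext; simpl; lra).
  ring.
Qed.

(** With [y = t / sqrt n], the main part [y ^ 2 / 2 + Ci * y] of the logarithm, times [- 2 * n],
    contributes [- t ^ 2] and an imaginary term cancelling [2 * sqrt n * t]: the linear term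
    disappears at a saddle point. What is left besides [- 2 * t ^ 2] is [2 * z] times the logarithm
    and [- 2 * n] times its expansion error. *)
Lemma saddle_bound (n t : R) (z : C) :
  1 <= n ->
  Cmod (Cexp (saddle n z t) - Cexp (RtoC (- 2 * t ^ 2)))%C <=
  / sqrt n * ((8 * Cmod z + 120) * exp (0 + (4 * Cmod z + 1) * Rabs t - 1 * t ^ 2)).
Proof.
  intros Hn.
  assert (Hk : 1 <= sqrt n) by (rewrite <- sqrt_1; now apply sqrt_le_1_alt).
  assert (Hkk := sqrt_sqrt n ltac:(lra)).
  set (k := sqrt n) in *; set (y := t / k).
  assert (Hz := Cmod_ge_0 z); assert (Ht := Rabs_pos t).
  assert (Hik : 0 < / k <= 1).
  { split; [apply Rinv_0_lt_compat; lra | rewrite <- Rinv_1; apply Rinv_le_contravar; lra]. }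
  assert (Hy : Rabs y = Rabs t * / k).
  { unfold y, Rdiv; rewrite Rabs_mult, (Rabs_pos_eq (/ k)); lra. }
  assert (HyT : Rabs y <= Rabs t) by nra.
  assert (HL := Clog_1_y_le y); assert (HX := Clog_1_y_expand y).
  (* The logarithm of [1 + Ci * y] has nonnegative real part, so the term in [- n] can only lower
     the exponent; the bound is uniform in [n]. *)
  assert (HRe : Re (saddle n z t) <= 4 * Cmod z * Rabs t - t ^ 2).
  { unfold saddle; fold k y.
    replace (Re (2 * (z - RtoC n) * Clog (1%R, y) + ((- t ^ 2)%R, (2 * k * t)%R))%C) with
      (Re (2 * z * Clog (1%R, y))%C - 2 * n * Re (Clog (1, y)) - t ^ 2)
      by (simpl; unfold Re, Im; ring).
    assert (0 <= Re (Clog (1, y))).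
    { rewrite Clog_1_y; simpl; apply Rmult_le_pos; [lra|].
      rewrite <- ln_1; apply ln_le; nra. }
    assert (H2 := Re_le_Cmod (2 * z * Clog (1%R, y))%C).
    rewrite !Cmod_mult, Cmod_R, Rabs_pos_eq in H2 by lra.
    assert (2 * Cmod z * Cmod (Clog (1, y)) <= 2 * Cmod z * (2 * Rabs t))
      by (apply Rmult_le_compat_l; lra).
    nra. }
  eapply Rle_trans.
  { apply (Cmod_Cexp_sub_le _ _ (4 * Cmod z * Rabs t - t ^ 2)); [exact HRe|].
    simpl; nra. }
  assert (HD : Cmod (saddle n z t - RtoC (- 2 * t ^ 2))%C <=
    / k * ((4 * Cmod z + 60) * exp (Rabs t))).
  { unfold saddle; fold k y.
    replace (2 * (z - RtoC n) * Clog (1%R, y) + ((- t ^ 2)%R, (2 * k * t)%R) - RtoC (- 2 * t ^ 2))%C with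
      (2 * z * Clog (1%R, y) + RtoC (- 2 * n) * (Clog (1%R, y) - ((y ^ 2 / 2)%R, y)))%C.
    2: { assert (Ety : t = k * y) by (unfold y; field; lra).
         rewrite Ety, <- Hkk; destruct z as [z1 z2], (Clog (1, y)) as [l1 l2].
         apply C_ext; simpl; field. }
    apply Rle_trans with (1 := Cmod_triangle _ _).
    rewrite !Cmod_mult, !Cmod_R, (Rabs_pos_eq 2) by lra.
    replace (Rabs (- 2 * n)) with (2 * n)
      by (rewrite Rabs_left by lra; ring).
    (* The powers of [x = Rabs t] are bounded by factorials times [exp x]; the 60 below is
       [2 * (4! + 3!)]. *)
    assert (P1 := pow_fact_le_exp (Rabs t) 1 Ht).
    assert (P3 := pow_fact_le_exp (Rabs t) 3 Ht).
    assert (P4 := pow_fact_le_exp (Rabs t) 4 Ht).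
    set (x := Rabs t) in *; set (e := exp x) in *.
    replace (x ^ 1 / INR (fact 1)) with x in P1 by (simpl; field).
    replace (x ^ 3 / INR (fact 3)) with (x ^ 3 / 6) in P3 by (simpl; field).
    replace (x ^ 4 / INR (fact 4)) with (x ^ 4 / 24) in P4 by (simpl; field).
    assert (B1 : 2 * Cmod z * Cmod (Clog (1, y)) <= / k * (4 * Cmod z * e)).
    { apply Rle_trans with (2 * Cmod z * (2 * Rabs y)); [apply Rmult_le_compat_l; lra|].
      rewrite Hy; replace (/ k * (4 * Cmod z * e)) with (2 * Cmod z * (2 * (e * / k))) by ring.
      apply Rmult_le_compat_l; [lra|]; nra. }
    assert (B2 : 2 * n * Cmod (Clog (1%R, y) - ((y ^ 2 / 2)%R, y))%C <= / k * (60 * e)).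
    { apply Rle_trans with (2 * n * (Rabs y ^ 4 + Rabs y ^ 3));
        [apply Rmult_le_compat_l; lra|].
      rewrite Hy, <- Hkk.
      replace (2 * (k * k) * ((x * / k) ^ 4 + (x * / k) ^ 3)) with
        (/ k * (2 * (x ^ 4 * / k + x ^ 3))) by (field; lra).
      apply Rmult_le_compat_l; [lra|].
      assert (0 <= x ^ 4) by (apply pow_le; lra).
      assert (x ^ 4 * / k <= x ^ 4 * 1) by (apply Rmult_le_compat_l; lra).
      lra. }
    lra. }
  apply Rle_trans with
    (2 * ((/ k * ((4 * Cmod z + 60) * exp (Rabs t))) * exp (4 * Cmod z * Rabs t - t ^ 2))).
  { apply Rmult_le_compat_l; [lra|].
    apply Rmult_le_compat_r; [apply Rlt_le, exp_pos | exact HD]. }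
  right; replace (0 + (4 * Cmod z + 1) * Rabs t - 1 * t ^ 2) with
    (Rabs t + (4 * Cmod z * Rabs t - t ^ 2)) by ring.
  rewrite exp_plus; ring.
Qed.

(** The integrand is positive and at least [exp (- 2)] on [[- 1, 1]], so truncated integrals stay
    above [2 * exp (- 2)]. *)
Lemma gauss_integral_neq_0 :
  exists M, dominated (fun t => Cexp (RtoC (- 2 * t ^ 2))) M /\
    integral_R (fun t => Cexp (RtoC (- 2 * t ^ 2))) <> RtoC 0.
Proof.
  set (f := fun t => Cexp (RtoC (- 2 * t ^ 2))).
  assert (Hr : forall t, continuous (fun t => exp (- 2 * t ^ 2)) t).
  { intros t; eapply continuous_real; auto_derive; trivial. }
  assert (Hf : forall t, f t = RtoC (exp (- 2 * t ^ 2))) by (intros; apply Cexp_RtoC).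
  assert (Hg : gaussian f 0 0 2).
  { split.
    - intros t; apply continuous_C.
      + apply continuous_ext with (2 := Hr t); intros u; now rewrite Hf.
      + apply continuous_ext with (2 := continuous_const 0 t); intros u; now rewrite Hf.
    - intros t; unfold f; rewrite Cmod_Cexp; right; f_equal; simpl; ring. }
  eexists; split; [exact (gaussian_dominated _ _ _ _ Rlt_0_2 Hg)|].
  intros E.
  assert (L := integral_R_lim _ _ (gaussian_dominated _ _ _ _ Rlt_0_2 Hg)).
  rewrite E in L.
  assert (LR := filterlim_comp _ _ _ _ Re _ _ _ L
    (continuous_Re _ (fun z => z) _ (continuous_id (RtoC 0)))).
  assert (Hex : forall a b, ex_RInt (fun t => exp (- 2 * t ^ 2)) a b).
  { intros a b; apply (ex_RInt_continuous (V := R_CompleteNormedModule)); auto. }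
  assert (Hlow : forall T, 1 <= T -> 2 * exp (- (2)) <= Re (RIntC f (- T) T)).
  { intros T HT; rewrite RIntC_parts by apply Hg.
    change (2 * exp (- (2)) <= RInt (fun t => Re (f t)) (- T) T).
    rewrite (RInt_ext _ (fun t => exp (- 2 * t ^ 2))) by (intros; now rewrite Hf).
    rewrite <- (RInt_Chasles _ (- T) (- 1) T), <- (RInt_Chasles _ (- 1) 1 T) by apply Hex.
    assert (P1 : 0 <= RInt (fun t => exp (- 2 * t ^ 2)) (- T) (- 1)).
    { apply RInt_ge_0; [lra | apply Hex | intros; apply Rlt_le, exp_pos]. }
    assert (P2 : 0 <= RInt (fun t => exp (- 2 * t ^ 2)) 1 T).
    { apply RInt_ge_0; [lra | apply Hex | intros; apply Rlt_le, exp_pos]. }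
    assert (P3 : 2 * exp (- (2)) <= RInt (fun t => exp (- 2 * t ^ 2)) (- 1) 1).
    { replace (2 * exp (- (2))) with (RInt (fun _ => exp (- (2))) (- 1) 1)
        by (rewrite RInt_const; change ((1 - -1) * exp (- (2)) = 2 * exp (- (2))); ring).
      apply RInt_le; [lra | apply ex_RInt_const | apply Hex |].
      intros x Hx; apply exp_mono; nra. }
    unfold plus; simpl; simpl in P1, P2, P3; lra. }
  assert (Hp := exp_pos (- (2))).
  assert (N : locally 0 (fun x => x < 2 * exp (- (2)))).
  { apply (locally_interval _ _ m_infty (2 * exp (- (2)))); simpl; trivial; lra. }
  destruct (LR _ N) as [T0 HT0].
  specialize (HT0 (Rmax T0 0 + 1) ltac:(generalize (Rmax_l T0 0); lra)).
  specialize (Hlow (Rmax T0 0 + 1) ltac:(generalize (Rmax_r T0 0); lra)).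
  lra.
Qed.

(** If [G] vanished at [z], the normalised kernel at [z - n] would have integral 0 for every [n].
    Subtracting it from the Gaussian leaves [J] unchanged but makes it [O(1 / sqrt n)], hence 0. *)
Lemma Ikern_0_neq_0 (sigma : R) (z : C) :
  0 < sigma ->
  (forall n : nat, (1 <= n)%nat -> (z + RtoC (/ 2))%C <> RtoC (INR n)) ->
  Ikern 0 1 sigma z <> RtoC 0.
Proof.
  intros Hs Hz H0.
  destruct gauss_integral_neq_0 as [M [HM HJ]]; apply HJ.
  set (J := integral_R _) in *.
  set (K := (8 * Cmod z + 120) * gauss_const 0 (4 * Cmod z + 1) 1).
  assert (B : forall n : nat, (1 <= n)%nat -> Cmod J <= / sqrt (INR n) * K * PI).
  { intros n Hn; assert (Hn1 : 1 <= INR n) by (apply (le_INR 1) in Hn; exact Hn).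
    assert (Hk : 0 < sqrt (INR n)) by (apply sqrt_lt_R0; lra).
    assert (Hzero := Ikern_0_zero_down sigma z n Hs Hz H0).
    rewrite (Ikern_shift 0 1 (sigma + sqrt (INR n)) sigma (sqrt (INR n))) in Hzero;
      try lra; auto using nz_0, Rabs_0_le_1.
    assert (HI := is_Ikern 0 1 (sqrt (INR n)) (z - RtoC (INR n)) Rabs_0_le_1 Hk Rlt_0_1 (nz_0 _)).
    rewrite Hzero in HI.
    set (c := (2 * (z - RtoC (INR n)) * RtoC (ln (sqrt (INR n))) + RtoC (INR n))%C).
    (* [Cexp (- c)] removes the constant factored out in [kern_saddle]; the sign turns the sum below
       into a difference. *)
    apply (is_integral_R_Cscal _ (- (1) * Cexp (- c))%C) in HI.
    assert (Hsum := is_integral_R_plus _ _ _ _ (is_integral_R_dominated _ _ HM) HI).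
    fold J in Hsum.
    set (h := fun t => _) in Hsum.
    assert (Eh : forall t, h t =
      (- (1) * (Cexp (saddle (INR n) z t) - Cexp (RtoC (- 2 * t ^ 2))))%C).
    { intros t; unfold h; rewrite kern_saddle by lra; fold c.
      replace (- (1) * Cexp (- c) * (Cexp c * Cexp (saddle (INR n) z t)))%C with
        (- (1) * (Cexp (- c) * Cexp c) * Cexp (saddle (INR n) z t))%C by ring.
      rewrite <- Cexp_plus; replace (- c + c)%C with (RtoC 0) by ring.
      rewrite Cexp_0; ring. }
    replace J with (integral_R h).
    2: { rewrite (is_integral_R_unique _ _ Hsum); ring. }
    apply integral_R_bound; split.
    - intros t; apply continuous_Cplus; [apply HM|].
      apply continuous_Cmult; [apply continuous_const|].
      apply kern_continuous; [trivial | apply nz_0].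
    - intros t; rewrite Eh, Cmod_mult.
      replace (Cmod (- (1))%C) with 1 by (rewrite Cmod_opp, Cmod_1; reflexivity).
      rewrite Rmult_1_l; apply Rle_trans with (1 := saddle_bound _ t z Hn1).
      unfold K, Rdiv; rewrite !Rmult_assoc.
      apply Rmult_le_compat_l; [now apply Rlt_le, Rinv_0_lt_compat|].
      apply Rmult_le_compat_l; [generalize (Cmod_ge_0 z); lra|].
      apply gauss_le; lra. }
  apply Cmod_eq_0.
  destruct (Cmod_ge_0 J) as [HJ0 | HJ0]; [exfalso | now symmetry].
  assert (HP := PI_RGT_0).
  assert (HK : 0 < K).
  { unfold K, gauss_const; generalize (Cmod_ge_0 z) (exp_pos (0 + (4 * Cmod z + 1 + 1) ^ 2 / (4 * 1))).
    intros; nra. }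
  set (m := K * PI / Cmod J).
  assert (Hm : 0 < m) by (apply Rdiv_lt_0_compat; nra).
  destruct (INR_unbounded (m ^ 2 + 1)) as [n Hn].
  assert (Hn1 : (1 <= n)%nat).
  { apply INR_le; simpl; generalize (pow2_ge_0 m); lra. }
  specialize (B n Hn1).
  assert (Hmk : m < sqrt (INR n)).
  { rewrite <- (sqrt_pow2 m) by lra; apply sqrt_lt_1_alt; split; [apply pow2_ge_0 | lra]. }
  assert (E : Cmod J * m = K * PI) by (unfold m; field; lra).
  assert (Cmod J * sqrt (INR n) <= K * PI).
  { apply Rmult_le_compat_r with (r := sqrt (INR n)) in B; [|lra].
    replace (/ sqrt (INR n) * K * PI * sqrt (INR n)) with (K * PI) in B by (field; lra).
    exact B. }
  nra.
Qed.

(** * Analytic continuation *)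

Definition real_analytic (f : R -> R) (x : R) :=
  exists (r : R) (a : nat -> R), 0 < r /\
    forall h, Rabs h < r -> is_pseries (V := R_NormedModule) a h (f (x + h)).

(** If the radius were at most [Rabs h], the terms at the midpoint [h'] between [Rabs h] and [r]
    would not tend to 0, although the series converges there. *)
Lemma CV_radius_of_disk (a : nat -> R) (r : R) :
  (forall h, Rabs h < r -> ex_pseries a h) ->
  forall h, Rabs h < r -> Rbar_lt (Rabs h) (CV_radius a).
Proof.
  intros H h Hh; apply Rbar_not_le_lt; intros Hle.
  set (h' := (Rabs h + r) / 2).
  assert (Hp := Rabs_pos h).
  assert (Hh' : Rabs h' = h') by (apply Rabs_pos_eq; unfold h'; lra).
  apply (CV_disk_outside a h').
  - rewrite Hh'; apply Rbar_le_lt_trans with (1 := Hle); simpl; unfold h'; lra.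
  - assert (E : ex_series (fun n => a n * h' ^ n)).
    { apply ex_series_ext with (2 := H h' ltac:(rewrite Hh'; unfold h'; lra)).
      intros n; rewrite pow_n_pow; unfold scal; simpl; unfold mult; simpl; ring. }
    exact (ex_series_lim_0 _ E).
Qed.

Lemma real_analytic_minus (f g : R -> R) (x : R) :
  real_analytic f x -> real_analytic g x -> real_analytic (fun t => f t - g t) x.
Proof.
  intros (r & a & Hr & Ha) (r' & b & Hr' & Hb).
  exists (Rmin r r'), (PS_minus a b); split; [now apply Rmin_glb_lt|].
  intros h Hh; apply (is_pseries_minus (V := R_NormedModule)).
  - apply Ha, Rlt_le_trans with (1 := Hh), Rmin_l.
  - apply Hb, Rlt_le_trans with (1 := Hh), Rmin_r.
Qed.

Lemma real_analytic_plus (f g : R -> R) (x : R) :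
  real_analytic f x -> real_analytic g x -> real_analytic (fun t => f t + g t) x.
Proof.
  intros (r & a & Hr & Ha) (r' & b & Hr' & Hb).
  exists (Rmin r r'), (PS_plus a b); split; [now apply Rmin_glb_lt|].
  intros h Hh; apply (is_pseries_plus (V := R_NormedModule)).
  - apply Ha, Rlt_le_trans with (1 := Hh), Rmin_l.
  - apply Hb, Rlt_le_trans with (1 := Hh), Rmin_r.
Qed.

Lemma real_analytic_mult (f g : R -> R) (x : R) :
  real_analytic f x -> real_analytic g x -> real_analytic (fun t => f t * g t) x.
Proof.
  intros (r & a & Hr & Ha) (r' & b & Hr' & Hb).
  exists (Rmin r r'), (PS_mult a b); split; [now apply Rmin_glb_lt|].
  intros h Hh.
  assert (H1 : Rabs h < r) by (apply Rlt_le_trans with (1 := Hh), Rmin_l).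
  assert (H2 : Rabs h < r') by (apply Rlt_le_trans with (1 := Hh), Rmin_r).
  apply is_pseries_mult; auto.
  - apply CV_radius_of_disk with r; trivial; intros u Hu; eexists; now apply Ha.
  - apply CV_radius_of_disk with r'; trivial; intros u Hu; eexists; now apply Hb.
Qed.

Lemma CV_radius_decr_n (a : nat -> R) (n : nat) : CV_radius (PS_decr_n a n) = CV_radius a.
Proof.
  induction n as [|n IH]; [now apply CV_radius_ext|].
  rewrite <- IH, <- (CV_radius_decr_1 (PS_decr_n a n)); apply CV_radius_ext; intros k.
  unfold PS_decr_1, PS_decr_n; f_equal; lia.
Qed.

(** By induction all lower coefficients vanish, so dividing by [h ^ n] leaves a series that is
    continuous at 0 with value [a n] and vanishes at small negative [h]. One side suits the supremum
    argument below, where zeros are known only to the left. *)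
Lemma pseries_zero_left (a : nat -> R) (r : R) :
  0 < r -> (forall h, Rabs h < r -> ex_pseries a h) ->
  (forall h, - r < h < 0 -> PSeries a h = 0) -> forall n, a n = 0.
Proof.
  intros Hr Hex H0 n; induction n as [n IH] using (well_founded_induction lt_wf).
  set (b := PS_decr_n a n).
  assert (Hcv : Rbar_lt (Rabs 0) (CV_radius b)).
  { unfold b; rewrite CV_radius_decr_n; apply CV_radius_of_disk with r; trivial.
    now rewrite Rabs_R0. }
  assert (Hc := PSeries_continuity b 0 Hcv).
  assert (Hb0 : PSeries b 0 = a n).
  { rewrite PSeries_0; unfold b, PS_decr_n; f_equal; lia. }
  destruct (Req_dec (a n) 0) as [|Hn]; [trivial | exfalso].
  apply continuity_pt_filterlim in Hc; rewrite Hb0 in Hc.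
  assert (Hloc : locally (a n) (fun y => y <> 0)).
  { exists (mkposreal _ (Rabs_pos_lt _ Hn)); intros y Hy E; rewrite E in Hy.
    change (Rabs (0 - a n) < Rabs (a n)) in Hy.
    unfold Rminus in Hy; rewrite Rplus_0_l, Rabs_Ropp in Hy; lra. }
  destruct (Hc _ Hloc) as [e He].
  set (h := - (Rmin r e / 2)).
  assert (Hm : 0 < Rmin r e) by (apply Rmin_glb_lt; [trivial | apply e]).
  assert (Hh : - r < h < 0) by (unfold h; generalize (Rmin_l r e); lra).
  apply (He h).
  - change (Rabs (h - 0) < e); rewrite Rminus_0_r, Rabs_left by lra.
    unfold h; generalize (Rmin_r r e); lra.
  - assert (E := H0 h Hh); rewrite (PSeries_decr_n_aux a n h IH) in E.
    apply Rmult_integral in E; destruct E as [E|E]; [|exact E].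
    exfalso; revert E; apply pow_nonzero; lra.
Qed.

(** Let [m] be the supremum of the points up to which [f] vanishes. The expansion at [m] is zero, so
    [f] vanishes on both sides of [m]; this contradicts the choice of [m] unless [m = 1]. *)
Lemma real_identity_theorem (f : R -> R) (delta : R) :
  0 < delta -> (forall x, 0 <= x <= 1 -> real_analytic f x) ->
  (forall x, 0 <= x <= delta -> f x = 0) -> f 1 = 0.
Proof.
  intros Hd Ha H0.
  set (P := fun x => 0 <= x <= 1 /\ forall y, 0 <= y <= x -> f y = 0).
  destruct (completeness P) as [m [Hub Hlub]].
  - exists 1; intros x [Hx _]; lra.
  - exists 0; split; [lra | intros y Hy; apply H0; lra].
  - assert (Hm0 : Rmin delta 1 <= m).
    { apply Hub; split; [split; [apply Rmin_glb; lra | apply Rmin_r]|].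
      intros y Hy; apply H0; generalize (Rmin_l delta 1); lra. }
    assert (Hmp : 0 < m) by (apply Rlt_le_trans with (2 := Hm0), Rmin_glb_lt; lra).
    assert (Hm1 : m <= 1) by (apply Hlub; intros x [Hx _]; lra).
    assert (Hlt : forall y, 0 <= y < m -> f y = 0).
    { intros y Hy; destruct (Req_dec (f y) 0) as [|Hne]; [trivial | exfalso].
      apply (Rlt_not_le m y); [lra|].
      apply Hlub; intros x [Hx1 Hx2]; destruct (Rle_dec x y); [trivial|].
      exfalso; apply Hne, Hx2; lra. }
    destruct (Ha m ltac:(lra)) as (r & a & Hr & Hs).
    assert (Hz : forall n, a n = 0).
    { apply pseries_zero_left with (Rmin r m).
      - now apply Rmin_glb_lt.
      - intros h Hh; eexists; apply Hs, Rlt_le_trans with (1 := Hh), Rmin_l.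
      - intros h Hh; generalize (Rmin_l r m) (Rmin_r r m); intros K1 K2.
        assert (Habs : Rabs h < r) by (rewrite Rabs_left; lra).
        rewrite (is_pseries_unique _ _ _ (Hs h Habs)); apply Hlt; lra. }
    assert (Hf : forall h, Rabs h < r -> f (m + h) = 0).
    { intros h Hh; rewrite <- (is_pseries_unique _ _ _ (Hs h Hh)).
      rewrite (PSeries_ext a (fun _ => 0)) by trivial; apply PSeries_const_0. }
    destruct (Rlt_le_dec m 1) as [Hm | Hm].
    + exfalso; assert (m + Rmin (r / 2) (1 - m) <= m); [apply Hub; split|].
      * assert (0 < Rmin (r / 2) (1 - m)) by (apply Rmin_glb_lt; lra).
        generalize (Rmin_r (r / 2) (1 - m)); lra.
      * intros y Hy; destruct (Rlt_le_dec y m) as [Hy'|Hy']; [apply Hlt; lra|].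
        replace y with (m + (y - m)) by ring; apply Hf.
        rewrite Rabs_pos_eq; generalize (Rmin_l (r / 2) (1 - m)); lra.
      * assert (0 < Rmin (r / 2) (1 - m)) by (apply Rmin_glb_lt; lra); lra.
    + replace 1 with (m + 0) by lra; apply Hf; now rewrite Rabs_R0.
Qed.

Definition Creal_analytic (f : R -> C) (x : R) :=
  exists (r : R) (a : nat -> C), 0 < r /\
    forall h, Rabs h < r -> Cpseries a h (f (x + h)).

Lemma Creal_analytic_Re (f : R -> C) (x : R) :
  Creal_analytic f x -> real_analytic (fun t => Re (f t)) x.
Proof.
  intros (r & a & Hr & Ha); exists r, (fun k => Re (a k)); split; [trivial|].
  intros h Hh; exact (proj1 (Ha h Hh)).
Qed.

Lemma Creal_analytic_Im (f : R -> C) (x : R) :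
  Creal_analytic f x -> real_analytic (fun t => Im (f t)) x.
Proof.
  intros (r & a & Hr & Ha); exists r, (fun k => Im (a k)); split; [trivial|].
  intros h Hh; exact (proj2 (Ha h Hh)).
Qed.

Lemma pow_n_Cpow (z : C) (k : nat) : pow_n (K := C_Ring) z k = Cpow z k.
Proof. induction k as [|k IH]; [reflexivity|]; simpl; rewrite IH; reflexivity. Qed.

Lemma Cpseries_of_is_pseries (u : nat -> C) (d l : C) (h : R) :
  is_pseries (K := C_AbsRing) (V := C_NormedModule) u (RtoC h * d)%C l ->
  Cpseries (fun k => Cpow d k * u k)%C h l.
Proof.
  intros H.
  assert (E : forall k, (pow_n (K := C_Ring) (RtoC h * d) k * u k)%C =
    (RtoC (h ^ k) * (Cpow d k * u k))%C).
  { intros k; rewrite pow_n_Cpow, Cpow_mult_distr, Cpow_RtoC; ring. }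
  split; unfold is_pseries, is_series.
  - apply filterlim_ext with
      (fun n => Re (Csum (fun k => pow_n (K := C_Ring) (RtoC h * d) k * u k)%C n)).
    { intros n; rewrite Re_Csum; apply sum_n_ext; intros k.
      transitivity (h ^ k * Re (Cpow d k * u k)%C).
      - rewrite E; simpl; unfold Re, Im; ring.
      - rewrite <- pow_n_pow; reflexivity. }
    exact (filterlim_comp _ _ _ _ Re _ _ _ H
      (continuous_Re C_UniformSpace (fun z => z) l (continuous_id l))).
  - apply filterlim_ext with
      (fun n => Im (Csum (fun k => pow_n (K := C_Ring) (RtoC h * d) k * u k)%C n)).
    { intros n; rewrite Im_Csum; apply sum_n_ext; intros k.
      transitivity (h ^ k * Im (Cpow d k * u k)%C).
      - rewrite E; simpl; unfold Re, Im; ring.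
      - rewrite <- pow_n_pow; reflexivity. }
    exact (filterlim_comp _ _ _ _ Im _ _ _ H
      (continuous_Im C_UniformSpace (fun z => z) l (continuous_id l))).
Qed.

Lemma analytic_at_line (f : C -> C) (p d : C) (x : R) :
  analytic_at f (p + RtoC x * d)%C -> Creal_analytic (fun t => f (p + RtoC t * d)%C) x.
Proof.
  intros (r & u & Hr & Hu).
  assert (Hd := Cmod_ge_0 d).
  (* Restricting to direction [d] multiplies the [k]-th coefficient by [d ^ k]; the [+ 1] in the
     radius covers [d = 0]. *)
  exists (r / (Cmod d + 1)), (fun k => Cpow d k * u k)%C.
  split; [apply Rdiv_lt_0_compat; lra|].
  intros h Hh; apply Cpseries_of_is_pseries.
  assert (E : (p + RtoC (x + h) * d - (p + RtoC x * d))%C = (RtoC h * d)%C)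
    by (rewrite RtoC_plus; ring).
  rewrite <- E; apply Hu; rewrite E, Cmod_mult, Cmod_R.
  apply Rmult_lt_compat_r with (r := Cmod d + 1) in Hh; [|lra].
  replace (r / (Cmod d + 1) * (Cmod d + 1)) with r in Hh by (field; lra).
  generalize (Rabs_pos h); nra.
Qed.

(** Moving by [h] along [d] multiplies the kernel by [Cexp (h * (2 * d * Clog w))], of the form
    treated in [integral_Cexp_series]. The expansion converges for all [h], so the radius 1 is
    arbitrary. *)
Lemma Ikern_line_analytic (eps alpha sigma : R) (p d : C) (x : R) :
  Rabs eps <= 1 -> 0 < sigma -> 0 < alpha -> nz eps sigma ->
  Creal_analytic (fun t => Ikern eps alpha sigma (p + RtoC t * d)%C) x.
Proof.
  intros He Hs Ha Hn.
  set (c := (p + RtoC x * d)%C).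
  destruct (kern_gaussian eps alpha sigma c He Hs (Rlt_le _ _ Ha) Hn) as (A & B & Hg).
  destruct (integral_Cexp_series _ (fun t => 2 * d * Clog (sigma, t))%C A B alpha
    (2 * Cmod d * (Rabs (ln sigma) + 2 + sigma)) (2 * Cmod d) Ha Hg) as [a H].
  - intros t; apply continuous_Cmult; [apply continuous_const|].
    apply continuous_vline, continuous_Clog, Hs.
  - intros t; rewrite !Cmod_mult, Cmod_R, Rabs_pos_eq by lra.
    assert (K := Cmod_Clog_le (sigma, t) sigma ltac:(simpl; lra)); simpl in K.
    assert (Hd := Cmod_ge_0 d).
    apply Rle_trans with (2 * Cmod d * (Rabs (ln sigma) + 2 + sigma + Rabs t));
      [apply Rmult_le_compat_l; lra | right; ring].
  - exists 1, a; split; [lra|]; intros h _.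
    replace (Ikern eps alpha sigma (p + RtoC (x + h) * d)%C) with
      (integral_R (fun t => kern eps alpha c (sigma, t) *
        Cexp (RtoC h * (2 * d * Clog (sigma, t))))%C); [apply H|].
    apply integral_R_ext; intros t; unfold kern, c.
    set (D := (/ den eps (sigma, t))%C); set (L := Clog (sigma, t)).
    transitivity (Cexp (2 * (p + RtoC x * d) * L + RtoC alpha * ((sigma, t) * (sigma, t))) *
      Cexp (RtoC h * (2 * d * L)) * D)%C; [ring|].
    rewrite <- Cexp_plus, RtoC_plus; do 2 f_equal; ring.
Qed.

(** Nothing is divided by [G] here, so the identity also covers the integers from 2 on, where [G]
    vanishes. Both signs of [eps] are treated together, with analyticity of [Z] asked for off 1. *)
Lemma zeta_integral (eps a q sigma sigma0 : R) (Z : C -> C) (s : C) :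
  eps = 1 \/ eps = -1 -> (forall s, 0 < s < q -> nz eps s) -> / 4 < q ->
  0 < sigma < q -> 0 < sigma0 -> 0 < a ->
  (forall s, 1 < Re s ->
    is_series (K := C_AbsRing) (V := C_NormedModule) (zeta_term eps a s) (Z s)) ->
  (forall s, s <> RtoC 1 -> analytic_at Z s) ->
  s <> RtoC 1 ->
  (Z s * Ikern 0 1 sigma0 (s - RtoC (/ 2)))%C = Ikern eps a sigma (s - RtoC (/ 2))%C.
Proof.
  intros He Hn Hq Hs Hs0 Ha Hser Han Hs1.
  assert (He1 : Rabs eps <= 1)
    by (destruct He as [-> | ->]; unfold Rabs; destruct Rcase_abs; lra).
  (* The segment from p to s meets the real axis at most in s. *)
  set (p := (3, if Rle_dec 0 (Im s) then 1 else -1) : C).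
  set (d := (s - p)%C).
  set (l := fun t => (p + RtoC t * d)%C).
  set (p' := (p - RtoC (/ 2))%C).
  set (f := fun t => (Z (l t) * Ikern 0 1 sigma0 (p' + RtoC t * d) -
    Ikern eps a sigma (p' + RtoC t * d))%C).
  assert (Hl : forall t, 0 <= t <= 1 -> l t <> RtoC 1).
  { intros t Ht E; destruct s as [x y].
    assert (E1 := f_equal Re E); assert (E2 := f_equal Im E).
    unfold l, d, p in E1, E2; simpl in E1, E2.
    assert (t = 1 \/ t < 1) as [-> | Ht1] by lra.
    - apply Hs1; destruct (Rle_dec 0 y); apply C_ext; simpl; lra.
    - destruct (Rle_dec 0 y) as [Hy | Hy]; [|apply Rnot_le_lt in Hy]; nra. }
  (* Up to this [t] the real part moves by at most [/ 2] from 3, so it stays at least [5 / 2], which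
     is [2 <= Re z] in [zeta_integral_large]. *)
  assert (Hf0 : forall t, 0 <= t <= / (2 * (Rabs (Re d) + 1)) -> f t = RtoC 0).
  { intros t Ht.
    assert (Hd := Rabs_pos (Re d)).
    assert (Hre : 5 / 2 <= Re (l t)).
    { assert (E : Re (l t) = 3 + t * Re d) by (unfold l, p; simpl; unfold Re; ring).
      assert (Ht2 : t * (2 * (Rabs (Re d) + 1)) <= 1).
      { apply Rle_trans with (/ (2 * (Rabs (Re d) + 1)) * (2 * (Rabs (Re d) + 1))).
        - apply Rmult_le_compat_r; lra.
        - right; field; lra. }
      rewrite E; generalize (Rle_abs (- Re d)); rewrite Rabs_Ropp; nra. }
    assert (E : (p' + RtoC t * d)%C = (l t - RtoC (/ 2))%C) by (unfold p', l; ring).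
    unfold f; rewrite E.
    rewrite (zeta_integral_large eps a q sigma sigma0 (l t - RtoC (/ 2))%C (Z (l t)));
      trivial; [ring | | ].
    - replace (Re (l t - RtoC (/ 2))%C) with (Re (l t) - / 2) by (simpl; unfold Re; ring); lra.
    - replace (l t - RtoC (/ 2) + RtoC (/ 2))%C with (l t) by ring.
      apply Hser; lra. }
  assert (Hdel : 0 < / (2 * (Rabs (Re d) + 1)))
    by (apply Rinv_0_lt_compat; generalize (Rabs_pos (Re d)); lra).
  assert (HZ : forall x, 0 <= x <= 1 -> Creal_analytic (fun t => Z (l t)) x)
    by (intros x Hx; apply analytic_at_line, Han, Hl, Hx).
  assert (HG : forall x, Creal_analytic (fun t => Ikern 0 1 sigma0 (p' + RtoC t * d)%C) x).
  { intros x; apply Ikern_line_analytic; auto using nz_0, Rabs_0_le_1, Rlt_0_1. }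
  assert (HI : forall x, Creal_analytic (fun t => Ikern eps a sigma (p' + RtoC t * d)%C) x).
  { intros x; apply Ikern_line_analytic; trivial; [lra | now apply Hn]. }
  assert (H1 : f 1 = RtoC 0).
  { apply C_ext.
    - apply (real_identity_theorem (fun t => Re (f t)) _ Hdel).
      + intros x Hx; unfold f.
        apply (real_analytic_minus (fun t => Re (Z (l t) * Ikern 0 1 sigma0 (p' + RtoC t * d))%C)
          (fun t => Re (Ikern eps a sigma (p' + RtoC t * d)%C))).
        * apply (real_analytic_minus
            (fun t => Re (Z (l t)) * Re (Ikern 0 1 sigma0 (p' + RtoC t * d)%C))
            (fun t => Im (Z (l t)) * Im (Ikern 0 1 sigma0 (p' + RtoC t * d)%C)));
            apply real_analytic_mult;
            auto using Creal_analytic_Re, Creal_analytic_Im.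
        * apply Creal_analytic_Re, HI.
      + intros x Hx; now rewrite Hf0.
    - apply (real_identity_theorem (fun t => Im (f t)) _ Hdel).
      + intros x Hx; unfold f.
        apply (real_analytic_minus (fun t => Im (Z (l t) * Ikern 0 1 sigma0 (p' + RtoC t * d))%C)
          (fun t => Im (Ikern eps a sigma (p' + RtoC t * d)%C))).
        * apply (real_analytic_plus
            (fun t => Re (Z (l t)) * Im (Ikern 0 1 sigma0 (p' + RtoC t * d)%C))
            (fun t => Im (Z (l t)) * Re (Ikern 0 1 sigma0 (p' + RtoC t * d)%C)));
            apply real_analytic_mult;
            auto using Creal_analytic_Re, Creal_analytic_Im.
        * apply Creal_analytic_Im, HI.
      + intros x Hx; now rewrite Hf0. }
  unfold f in H1.
  replace (p' + RtoC 1 * d)%C with (s - RtoC (/ 2))%C in H1 by (unfold p', d; ring).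
  replace (l 1) with s in H1 by (unfold l, d; ring).
  set (u := (Z s * _)%C) in *; set (v := Ikern eps a sigma _) in *.
  replace u with ((u - v) + v)%C by ring; rewrite H1; ring.
Qed.

(** * The stated integrals as instances of the kernel, and the conclusion *)

Lemma G_integrand_kern (sigma t : R) (z : C) : G_integrand sigma z t = kern 0 1 z (sigma, t).
Proof.
  unfold G_integrand, kern, den, Cpower; rewrite Cexp_plus.
  replace (1 - RtoC 0 * Cexp ((sigma, t) * (sigma, t)))%C with (RtoC 1) by ring.
  rewrite Cmult_1_l; field.
Qed.

Lemma R_integrand_kern (sigma alpha t : R) (z : C) :
  R_integrand sigma z alpha t = kern 1 alpha z (sigma, t).
Proof.
  unfold R_integrand, kern, den, Cpower, Cdiv.
  now rewrite Cexp_plus, Cmult_assoc, Cmult_1_l.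
Qed.

Lemma D_integrand_kern (sigma alpha t : R) (z : C) :
  D_integrand sigma z alpha t = kern (-1) alpha z (sigma, t).
Proof.
  unfold D_integrand, kern, den, Cpower, Cdiv.
  replace (1 - RtoC (-1) * Cexp ((sigma, t) * (sigma, t)))%C with
    (1 + Cexp ((sigma, t) * (sigma, t)))%C by (apply C_ext; simpl; ring).
  now rewrite Cexp_plus, Cmult_assoc.
Qed.

Lemma ex_integral_R_kern (f : R -> C) (eps alpha sigma : R) (z : C) :
  (forall t, f t = kern eps alpha z (sigma, t)) ->
  Rabs eps <= 1 -> 0 < sigma -> 0 < alpha -> nz eps sigma -> ex_integral_R f.
Proof.
  intros Hf He Hs Ha Hn.
  replace f with (fun t => kern eps alpha z (sigma, t)).
  - destruct (kern_dominated eps alpha sigma z He Hs Ha Hn) as [M HM].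
    exact (ex_integral_R_dominated _ _ HM).
  - now apply functional_extensionality.
Qed.

(** The remainder estimate uses lines of abscissa up to [/ 4], which must lie in the zero-free
    strip. *)
Lemma quarter_lt_sqrt (x : R) : 1 <= x -> / 4 < sqrt x.
Proof.
  intros Hx; apply Rlt_le_trans with 1; [lra|].
  rewrite <- sqrt_1; now apply sqrt_le_1_alt.
Qed.

Theorem theorem3
  (a : R) (ha : 0 < a)
  (zeta eta : C -> C)
  (hzeta : is_hurwitz_zeta a zeta)
  (heta : is_alternating_hurwitz_zeta a eta)
  (s : C) (hs : forall n : nat, (1 <= n)%nat -> s <> RtoC (INR n))
  (sigma0 : R) (hsigma0 : 0 < sigma0) :
  let z : C := (s - RtoC (1 / 2))%C in
  ex_integral_R (G_integrand sigma0 z) /\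
  G_fun sigma0 z <> RtoC 0 /\
  (forall sigma : R, 0 < sigma < sqrt PI ->
     ex_integral_R (R_integrand sigma z a) /\
     zeta s = (R_fun sigma z a / G_fun sigma0 z)%C) /\
  (forall sigma : R, 0 < sigma < sqrt (PI / 2) ->
     ex_integral_R (D_integrand sigma z a) /\
     eta s = (D_fun sigma z a / G_fun sigma0 z)%C).
Proof.
  intros z.
  (* The shift is stated as [1 / 2] but appears as [/ 2] in the lemmas. *)
  assert (Hz : z = (s - RtoC (/ 2))%C) by (unfold z; do 3 f_equal; field).
  clearbody z; subst z; set (z := (s - RtoC (/ 2))%C).
  assert (HG : G_fun sigma0 z = Ikern 0 1 sigma0 z)
    by (apply integral_R_ext; intros t; apply G_integrand_kern).
  assert (HG0 : Ikern 0 1 sigma0 z <> RtoC 0).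
  { apply Ikern_0_neq_0; trivial.
    replace (z + RtoC (/ 2))%C with s by (unfold z; ring); exact hs. }
  assert (Hs1 : s <> RtoC 1) by (apply (hs 1%nat); auto).
  assert (HPI : 2 < PI) by (generalize PI2_1; lra).
  rewrite HG; split; [|split; [exact HG0 | split]].
  - apply (ex_integral_R_kern _ 0 1 sigma0 z); auto using nz_0, Rabs_0_le_1, Rlt_0_1.
    intros t; apply G_integrand_kern.
  - intros sigma Hsig; split.
    + apply (ex_integral_R_kern _ 1 a sigma z); auto using nz_1.
      * intros t; apply R_integrand_kern.
      * rewrite Rabs_R1; lra.
      * lra.
    + replace (R_fun sigma z a) with (Ikern 1 a sigma z)
        by (apply integral_R_ext; intros t; symmetry; apply R_integrand_kern).
      destruct hzeta as (H1 & H2 & _).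
      unfold z; rewrite <- (zeta_integral 1 a (sqrt PI) sigma sigma0 zeta s); trivial.
      * field; exact HG0.
      * now left.
      * intros; now apply nz_1.
      * apply quarter_lt_sqrt; lra.
      * intros u Hu; apply is_series_ext with (2 := H1 u Hu); intros n.
        unfold zeta_term; rewrite pow1; symmetry; apply Cmult_1_l.
  - intros sigma Hsig; split.
    + apply (ex_integral_R_kern _ (-1) a sigma z); auto using nz_m1.
      * intros t; apply D_integrand_kern.
      * unfold Rabs; destruct Rcase_abs; lra.
      * lra.
    + replace (D_fun sigma z a) with (Ikern (-1) a sigma z)
        by (apply integral_R_ext; intros t; symmetry; apply D_integrand_kern).
      destruct heta as (H1 & H2).
      unfold z; rewrite <- (zeta_integral (-1) a (sqrt (PI / 2)) sigma sigma0 eta s); trivial.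
      * field; exact HG0.
      * now right.
      * intros; now apply nz_m1.
      * apply quarter_lt_sqrt; lra.
Qed.
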